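(* Let $(X,d,\mathfrak{m})$ be a metric measure space with Cheeger energy $\mathsf{Ch}$, and let $S$ be the unit sphere of $L^2(\mathfrak{m})$. Assume that for every $M>0$ the sublevel set $$E^{1,M}=\{u\in L^2(\mathfrak{m}):\ \|u\|\le 1,\ \mathsf{Ch}(u)\le M\}$$ is compact in $L^2(\mathfrak{m})$. If for some $k,\ell\ge1$ and some $\lambda\in[0,\infty)$ it holds that $$\lambda_k(\mathsf{Ch})=\lambda_{k+1}(\mathsf{Ch})=\cdots=\lambda_{k+\ell-1}(\mathsf{Ch})=\lambda,$$ then $\gamma(K_\lambda)\ge\ell$. In particular $K_\lambda\ne\emptyset$, and therefore there exists $u\in S$ such that $$-\Delta u=\lambda_k(\mathsf{Ch})\,u.$$ Finally, if $\ell>1$ there are infinitely many solutions $u\in S$ to this equation.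
   Context: A metric measure space is a triple $(X,d,\mathfrak{m})$ with $(X,d)$ a complete separable metric space and $\mathfrak{m}$ a Borel probability measure on $X$ with $\mathrm{supp}\,\mathfrak{m}=X$. $\|\cdot\|$ and $\langle\cdot,\cdot\rangle$ are the norm and scalar product of $L^2(\mathfrak{m})$. Cheeger energy: for $f\in L^2(\mathfrak{m})$, $\mathsf{Ch}(f)=\inf\{\liminf_n\int|\nabla f_n|^2\,d\mathfrak{m}:\ f_n\in\mathrm{Lip}_b(X),\ \|f_n-f\|\to0\}\in[0,\infty]$, where $\mathrm{Lip}_b(X)$ is the set of bounded Lipschitz functions and $|\nabla g|(x)=\limsup_{y\to x}|g(y)-g(x)|/d(y,x)$ ($0$ at isolated points). It is convex, lower semicontinuous and $2$-homogeneous. Laplacian: for $u$ with $\mathsf{Ch}(u)<\infty$ and $\partial\frac12\mathsf{Ch}(u)\neq\emptyset$ (convex subdifferential in $L^2(\mathfrak{m})$), $-\Delta u$ is the element of minimal $L^2(\mathfrak{m})$ norm in $\partial\frac12\mathsf{Ch}(u)$. The equation $-\Delta u=\lambda u$ includes the requirement that $\Delta u$ is defined. Krasnoselskii genus: for a closed symmetric ($V=-V$) subset $V$ of $L^2(\mathfrak{m})$, $\gamma(\emptyset)=0$, and for $V\neq\emptyset$, $\gamma(V)=\inf\{m\in\mathbb{N}:\ \exists\,h\in C^0(V;\mathbb{R}^m\setminus\{0\})\ \text{odd}\}$, with value $\infty$ if no such $m$ exists. $\mathcal{F}_k$ is the family of compact symmetric subsets $V\subset S$ with $\gamma(V)\ge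 k$, and $\lambda_k(\mathsf{Ch})=\inf_{V\in\mathcal{F}_k}\sup_{u\in V}\mathsf{Ch}(u)$ (with $\inf\emptyset=+\infty$). The set $K_\lambda$: given $\lambda\ge0$, put $M=\lambda+1$, fix $L>M$, let $\Phi(u)=\mathsf{Ch}(u)$ if $u\in E^{1,M}$ and $\Phi(u)=+\infty$ otherwise, and $\Phi_L=\Phi-L\|\cdot\|^2$. The descending slope is $|\partial\Phi_L|(v)=\limsup_{w\to v}\frac{(\Phi_L(v)-\Phi_L(w))^+}{\|v-w\|}$. Then $K_\lambda=\{u\in S:\ \Phi(u)=\lambda,\ |\partial\Phi_L|(u)=0\}$. *)

(* Defs.v *)
From HB Require Import structures.
From mathcomp Require Import all_boot all_order all_algebra.
From mathcomp Require Import all_classical all_reals all_analysis.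
From mathcomp Require Import measurable_realfun.

Set Implicit Arguments.
Unset Strict Implicit.
Unset Printing Implicit Defensive.

Import Order.TTheory GRing.Theory Num.Theory.
Import numFieldNormedType.Exports.

Local Open Scope classical_set_scope.
Local Open Scope ring_scope.

Section L2.
Context d (T : measurableType d) (R : realType).
Variable mu : {measure set T -> \bar R}.
Local Notation L2 := (LspaceType2 mu).
Local Notation F2 := (LfunType mu (lee1n 2)).

HB.instance Definition _ := gen_eqMixin L2.
HB.instance Definition _ := gen_choiceMixin L2.

Definition L2fun (u : L2) : T -> R := u.

Lemma L2P (u v : L2) : u = v <-> L2fun u = L2fun v %[ae mu].
Proof.
split=> [-> //|uv]; first exact/aeW.
case: u v uv => [u [[Pu]]] [v [[Pv]]] /= uv.
have E : u = v.
  apply/eqP; rewrite -[u]reprK -[v]reprK; apply/eqP/eqmodP/asboolP; exact: uv.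
by subst v; rewrite (Prop_irrelevance Pu Pv).
Qed.

Lemma Lnorm2_ae (f g : T -> R) : measurable_fun setT f -> measurable_fun setT g ->
  f = g %[ae mu] -> 'N[mu]_2[EFin \o f]%E = 'N[mu]_2[EFin \o g]%E.
Proof.
move=> mf mg fg; rewrite unlock; congr (_ `^ _)%E.
have mN (h : T -> R) : measurable_fun setT h ->
    measurable_fun setT ((fun x => `|(EFin \o h) x| `^ 2)%E : T -> \bar R).
  move=> mh; apply/measurable_EFinP.
  apply: (@measurableT_comp _ _ _ _ _ _ (@powR R ^~ 2)) => //.
  exact: measurableT_comp.
apply: ge0_ae_eq_integral => //; [exact: mN|exact: mN| | |].
- by move=> x _; exact: poweR_ge0.
- by move=> x _; exact: poweR_ge0.
- by apply: filterS fg => x /= /[apply] ->.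
Qed.

Lemma measurable_L2fun (u : L2) : measurable_fun setT (L2fun u).
Proof. exact: (measurable_funPT (repr (u : {mfun_ mu, T >-> measurableTypeR R}))). Qed.

Lemma L2fun_Lfun (u : L2) : L2fun u \in Lfun mu 2%:E.
Proof.
rewrite inE; apply/andP; split; rewrite inE/=; first exact: measurable_L2fun.
exact: Lebesgue_finite.
Qed.

Section L2of.
Variables (f : T -> R) (fL : f \in Lfun mu 2%:E).

Let fm : T -> measurableTypeR R := f.

Let fm_meas : measurable_fun setT fm.
Proof. by move: fL; rewrite inE => /andP[]; rewrite inE. Qed.

HB.instance Definition _ :=
  @isMeasurableFun.Build _ _ T (measurableTypeR R) fm fm_meas.

Let q : {mfun_ mu, T >-> measurableTypeR R} :=
  (\pi_({mfun_ mu, T >-> measurableTypeR R}))%qT fm.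

Let q_ae : (q : T -> R) = f %[ae mu].
Proof.
have /asboolP : ae_eq_op mu (repr q) fm by rewrite -eqmodE reprK.
exact.
Qed.

Let q_fin : finite_norm mu 2%:E (q : T -> R).
Proof.
rewrite /finite_norm (@Lnorm2_ae q f)//.
- by move: fL; rewrite inE => /andP[_]; rewrite inE.
- exact: (measurable_funPT (repr q)).
Qed.

HB.instance Definition _ := @isFinLebesgue.Build _ T R mu 2%:E (lee1n 2) q q_fin.

Definition L2of : L2 := q.

Lemma L2ofE : L2fun L2of = f %[ae mu].
Proof. exact: q_ae. Qed.

End L2of.

Definition L2Lfun (u : L2) : F2 := Lfun_Sub (lee1n 2) (L2fun_Lfun u).

Lemma L2funD_Lfun (u v : L2) : L2fun u \+ L2fun v \in Lfun mu 2%:E.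
Proof. exact: (LfunP (L2Lfun u + L2Lfun v)). Qed.
Lemma L2funN_Lfun (u : L2) : \- L2fun u \in Lfun mu 2%:E.
Proof. exact: (LfunP (- L2Lfun u)). Qed.
Lemma L2funZ_Lfun (a : R) (u : L2) : a \*: L2fun u \in Lfun mu 2%:E.
Proof. exact: (LfunP (a *: L2Lfun u)). Qed.
Lemma cst0_Lfun : cst 0 \in Lfun mu 2%:E.
Proof. exact: (LfunP (0 : F2)). Qed.

Definition L2add u v : L2 := L2of (L2funD_Lfun u v).
Definition L2opp u : L2 := L2of (L2funN_Lfun u).
Definition L2scale a u : L2 := L2of (L2funZ_Lfun a u).
Definition L2zero : L2 := L2of cst0_Lfun.

Lemma L2addA : associative L2add.
Proof.
move=> u v w; apply/L2P.
apply: filterS (filterI (L2ofE (L2funD_Lfun u (L2add v w)))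
    (filterI (L2ofE (L2funD_Lfun v w))
    (filterI (L2ofE (L2funD_Lfun (L2add u v) w))
    (L2ofE (L2funD_Lfun u v))))) => x /=.
by move=> [e1 [e2 [e3 e4]]] _; rewrite e1// e3//= e2// e4//= addrA.
Qed.

Lemma L2addC : commutative L2add.
Proof.
move=> u v; apply/L2P.
apply: filterS (filterI (L2ofE (L2funD_Lfun u v))
    (L2ofE (L2funD_Lfun v u))) => x /=.
by move=> [e1 e2] _; rewrite e1// e2//= addrC.
Qed.

Lemma L2add0 : left_id L2zero L2add.
Proof.
move=> u; apply/L2P.
apply: filterS (filterI (L2ofE (L2funD_Lfun L2zero u))
    (L2ofE cst0_Lfun)) => x /=.
by move=> [e1 e2] _; rewrite e1//= e2// add0r.
Qed.

Lemma L2addN : left_inverse L2zero L2opp L2add.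
Proof.
move=> u; apply/L2P.
apply: filterS (filterI (L2ofE (L2funD_Lfun (L2opp u) u))
    (filterI (L2ofE (L2funN_Lfun u))
    (L2ofE cst0_Lfun))) => x /=.
by move=> [e1 [e2 e3]] _; rewrite e1//= e2// e3//= addNr.
Qed.

HB.instance Definition _ := GRing.isZmodule.Build L2 L2addA L2addC L2add0 L2addN.

Lemma L2funD (u v : L2) : L2fun (u + v) = L2fun u \+ L2fun v %[ae mu].
Proof. exact: L2ofE. Qed.

Lemma L2funN (u : L2) : L2fun (- u) = \- L2fun u %[ae mu].
Proof. exact: L2ofE. Qed.

Lemma L2scaleA a b (u : L2) : L2scale a (L2scale b u) = L2scale (a * b) u.
Proof.
apply/L2P.
apply: filterS (filterI (L2ofE (L2funZ_Lfun a (L2scale b u)))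
    (filterI (L2ofE (L2funZ_Lfun b u))
    (L2ofE (L2funZ_Lfun (a * b) u)))) => x /=.
by move=> [e1 [e2 e3]] _; rewrite e1//= e2// e3//= scalerA.
Qed.

Lemma L2scale1 : left_id 1 L2scale.
Proof.
move=> u; apply/L2P.
apply: filterS (L2ofE (L2funZ_Lfun 1 u)) => x /=.
by move=> e1 _; rewrite e1//= scale1r.
Qed.

Lemma L2scaleDr : right_distributive L2scale +%R.
Proof.
move=> a u v; apply/L2P.
apply: filterS (filterI (L2ofE (L2funZ_Lfun a (u + v)))
    (filterI (L2funD u v)
    (filterI (L2funD (L2scale a u) (L2scale a v))
    (filterI (L2ofE (L2funZ_Lfun a u))
    (L2ofE (L2funZ_Lfun a v)))))) => x /=.
by move=> [e1 [e2 [e3 [e4 e5]]]] _; rewrite e1//= e2// e3//= e4// e5//= scalerDr.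
Qed.

Lemma L2scaleDl (u : L2) : {morph L2scale^~ u : a b / a + b}.
Proof.
move=> a b; apply/L2P.
apply: filterS (filterI (L2ofE (L2funZ_Lfun (a + b) u))
    (filterI (L2funD (L2scale a u) (L2scale b u))
    (filterI (L2ofE (L2funZ_Lfun a u))
    (L2ofE (L2funZ_Lfun b u))))) => x /=.
by move=> [e1 [e2 [e3 e4]]] _; rewrite e1//= e2//= e3// e4//= scalerDl.
Qed.

HB.instance Definition _ :=
  GRing.Zmodule_isLmodule.Build R L2 L2scaleA L2scale1 L2scaleDr L2scaleDl.

Lemma L2funZ a (u : L2) : L2fun (a *: u) = a \*: L2fun u %[ae mu].
Proof. exact: L2ofE. Qed.

Lemma L2fun0 : L2fun (0 : L2) = cst 0 %[ae mu].
Proof. exact: L2ofE. Qed.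

Definition L2norm (u : L2) : R := fine 'N[mu]_2[EFin \o L2fun u]%E.

Lemma L2norm_ae (u : L2) (f : T -> R) (fL : f \in Lfun mu 2%:E) :
  L2fun u = f %[ae mu] ->
  L2norm u = fine 'N[mu]_2[EFin \o (Lfun_Sub (lee1n 2) fL : F2)]%E.
Proof.
move=> uf; rewrite /L2norm (@Lnorm2_ae _ f)//; first exact: measurable_L2fun.
by move: fL; rewrite inE => /andP[]; rewrite inE.
Qed.

Lemma ler_L2normD (u v : L2) : L2norm (u + v) <= L2norm u + L2norm v.
Proof.
rewrite (L2norm_ae (L2funD_Lfun u v) (L2funD u v)).
exact: (ler_LnormD (L2Lfun u)
  (L2Lfun v)).
Qed.

Lemma L2normZ a (u : L2) : L2norm (a *: u) = `|a| * L2norm u.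
Proof.
rewrite (L2norm_ae (L2funZ_Lfun a u) (L2funZ a u)) /=.
have := LnormZ (L2Lfun u) a => /= ->.
by rewrite fineM// -(finite_norm_fine (L2Lfun u)).
Qed.

Lemma L2norm0_eq0 (u : L2) : L2norm u = 0 -> u = 0.
Proof.
move=> u0; apply/L2P.
have := fine_Lnormr_eq0 (f := L2Lfun u) u0.
move=> ufe; apply: filterS (filterI ufe L2fun0) => x /= [e1 e2] _.
by rewrite e2//; exact: e1.
Qed.

HB.instance Definition _ :=
  Lmodule_isNormed.Build R L2 ler_L2normD L2normZ L2norm0_eq0.

Lemma L2normE (u : L2) : `|u| = fine 'N[mu]_2[EFin \o L2fun u]%E.
Proof. by []. Qed.

Definition L2inner (u v : L2) : R := \int[mu]_x (L2fun u x * L2fun v x).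

Lemma L2innerxx (u : L2) : L2inner u u = `|u| ^+ 2.
Proof.
rewrite L2normE -powR_mulrn ?fine_ge0 ?Lnorm_ge0//.
have fN := finite_norm_fine (L2Lfun u); rewrite /= in fN.
apply: EFin_inj; rewrite -poweR_EFin fN poweR_Lnorm ?pnatr_eq0//.
rewrite /L2inner /Rintegral fineK.
  apply: eq_integral => x _ /=.
  by rewrite powR_mulrn// real_normK ?num_real// expr2.
have /= := Lfun2_integrable_sqr (L2fun_Lfun u).
move=> /integrable_fin_num; apply => //.
Qed.

Definition subdifferential (F : L2 -> \bar R) (u : L2) : set L2 :=
  [set w | (F u < +oo)%E /\
    forall v, (F u + (L2inner w (v - u))%:E <= F v)%E].

End L2.

Section genus.
Context (R : realType) (V : normedModType R).

Definition unit_sphere : set V := [set u | `|u| = 1].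

Definition symmetric_set (A : set V) := [set - u | u in A] = A.

(* A map h from A to R^n minus the origin is encoded by a total function on V
   of which only the values on A matter. *)
Definition genus (A : set V) : \bar R :=
  if `[< A = set0 >] then 0%E else
  ereal_inf [set (n%:R)%:E | n in [set n : nat |
    exists h : V -> 'rV[R]_n,
      [/\ {within A, continuous h},
          forall u, A u -> h u <> 0 &
          forall u, A u -> h (- u) = - h u]]].

Definition genus_family (k : nat) : set (set V) :=
  [set A | [/\ compact A, symmetric_set A, A `<=` unit_sphere &
               ((k%:R)%:E <= genus A)%E]].

Definition minmax (F : V -> \bar R) (k : nat) : \bar R :=
  ereal_inf [set ereal_sup [set F u | u in A] | A in genus_family k].

Definition descending_slope (F : V -> \bar R) (v : V) : \bar R :=
  limf_esup
    (fun w => Order.max 0%E (F v - F w)%E * (`|v - w|^-1)%:E)%E v^'.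

End genus.

(* Completeness comes with a distinguished point in the library; this excludes
   only the empty space, which carries no probability measure. *)
#[short(type="completeMetricType")]
HB.structure Definition CompleteMetric (R : numDomainType) :=
  {T of Complete T & Metric R T}.

Notation borel X := (g_sigma_algebraType (@open X)).

Section cheeger.
Context (R : realType) (X : completeMetricType R).
Variable m : probability (borel X) R.
Local Notation L2 := (LspaceType2 m).

Definition separable := exists2 D : set X, countable D & dense D.

Definition measure_support : set X :=
  [set x | forall U : set X, open_nbhs x U -> (0 < m U)%E].

Definition metric_measure_space := separable /\ measure_support = [set: X].

Definition bounded_lipschitz (f : X -> R) :=
  (exists M : R, forall x, `|f x| <= M) /\
  (exists K : R, forall x y, `|f x - f y| <= K * mdist x y).

Definition local_slope (g : X -> R) (x : X) : \bar R :=
  if `[< isolated [set: X] x >] then 0%E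
  else limf_esup (fun y => (`|g y - g x| / mdist y x)%:E) x^'.

Definition cheeger (f : L2) : \bar R :=
  ereal_inf [set limn_einf (fun n => \int[m]_x (local_slope (g n) x ^+ 2)%E)%E
    | g in [set g : nat -> X -> R | (forall n, bounded_lipschitz (g n)) /\
        ('N[m]_2[EFin \o (g n \- L2fun f)%R] @[n --> \oo] --> 0)%E]].

(* w is the minimal-norm element of the closed convex set of subgradients of
   Ch/2 at u; it is unique when it exists. *)
Definition is_minus_laplacian (u w : L2) :=
  let D := subdifferential (fun v => (2^-1)%:E * cheeger v)%E u in
  D w /\ forall w', D w' -> `|w| <= `|w'|.

Definition energy_sublevel (M : R) : set L2 :=
  [set u | `|u| <= 1 /\ (cheeger u <= M%:E)%E].

Definition truncated_energy (M : R) (u : L2) : \bar R :=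
  if `[< energy_sublevel M u >] then cheeger u else +oo%E.

Definition critical_set (lam L : R) : set L2 :=
  let Phi := truncated_energy (lam + 1) in
  [set u | [/\ unit_sphere u, Phi u = lam%:E &
    descending_slope (fun v => Phi v - (L * `|v| ^+ 2)%:E)%E u = 0%E]].

End cheeger.

Arguments cheeger {R X} m f.
Arguments is_minus_laplacian {R X} m u w.
Arguments energy_sublevel {R X} m M.
Arguments truncated_energy {R X} m M u.
Arguments critical_set {R X} m lam L.

(* Main.v *)
Require Import Defs.
From HB Require Import structures.
From mathcomp Require Import all_boot all_order all_algebra.
From mathcomp Require Import all_classical all_reals all_analysis.
From mathcomp Require Import measurable_realfun lra ring zify.

(* A one-step deformation replaces the gradient flow. Put G(v) = |v|^2 + Ch(v);
   the ball {G <= 1} is compact and uniformly convex, so for |u| = 1 with finite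
   energy the maximum s(u) of <u, .> over it is attained at a unique point v(u), which is
   odd and Hoelder continuous in u. The map r(u) = v(u) / |v(u)| satisfies
     1 + Ch(r(u)) <= 1 / |v(u)|^2 <= 1 / s(u)^2 <= 1 + Ch(u),
   and 1 / s(u)^2 >= 1 + lam >= 1 + Ch(u) forces u to be critical at level lam.
   By compactness, r pushes the sublevel {Ch <= lam + e}, away from a
   neighbourhood of the critical set K, into {Ch <= lam - e}.
   If K had genus n < l, an odd map K -> R^n \ 0 would extend by Tietze to an odd
   map H on the whole space. On a competitor V for lambda_{k+l-1} of energy at
   most lam + e, the set V /\ {H = 0} is carried by r to a set of genus at most
   k - 1, hence has an odd map G to R^{k-1} not vanishing there; then (G, H) shows
   that V has genus at most k - 1 + n < k + l - 1, a contradiction.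
   By convexity, a vanishing slope of Phi_L at u in S with Ch(u) = lam amounts to
   lam u being a subgradient of Ch / 2 at u. *)

Set Implicit Arguments.
Unset Strict Implicit.
Unset Printing Implicit Defensive.

Import Order.TTheory GRing.Theory Num.Theory.
Import numFieldNormedType.Exports.

Local Open Scope classical_set_scope.
Local Open Scope ring_scope.

(** * Odd extensions and genus *)


Lemma continuous_row (R : realType) (T : topologicalType) n (h : T -> 'rV[R]_n) :
  (forall i, continuous (fun x => h x ord0 i)) -> continuous h.
Proof.
move=> hc x B [P hP sP]; apply: (@filterS _ (nbhs x)) => [y|].
  by apply: (sP (h y)).
have fP i : nbhs x [set y | forall j, P i j (h y i j)].
  apply: filter_forall => j; rewrite (ord1 i).
  by apply: (hc j x); have := hP ord0 j.
by apply: filter_forall => i; exact: fP.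
Qed.

Lemma compact_closed_normed (R : realType) (V : normedModType R) (A : set V) :
  compact A -> closed A.
Proof. by apply: compact_closed; exact: norm_hausdorff. Qed.

Section symmetric_sets.
Context (R : realType) (V : normedModType R).
Implicit Types A : set V.

Lemma symmetric_setP A : symmetric_set A <-> forall u, A u -> A (- u).
Proof.
split=> [As u Au|As]; first by rewrite -As; exists u.
apply/seteqP; split=> [_ [u Au <-]|u Au]; first exact: As.
by exists (- u); [exact: As|rewrite opprK].
Qed.

(** Tietze's theorem applies to each coordinate, which is bounded on the compact set [A]. Taking the
    odd part of the extension keeps the values on [A], where [h] is already odd. *)
Lemma odd_extension n A (h : V -> 'rV[R]_n) : compact A -> symmetric_set A ->
  {within A, continuous h} -> (forall u, A u -> h (- u) = - h u) ->
  exists H : V -> 'rV[R]_n, [/\ continuous H,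
    forall u, H (- u) = - H u & forall u, A u -> H u = h u].
Proof.
move=> cA /symmetric_setP sA ch oddh.
have clA := compact_closed_normed cA.
have ext i : exists g : V -> R, continuous g /\ forall u, A u -> g u = h u ord0 i.
  pose f u : R := h u ord0 i.
  have cf : {within A, continuous f}.
    move=> u; apply: (@continuous_comp (subspace A) _ _ h
      (fun M : 'rV[R]_n => M ord0 i)); [exact: ch|exact: coord_continuous].
  have [M [M0 fM]] : exists M : R, 0 < M /\ forall u, A u -> `|f u| <= M.
    have cfA : compact (f @` A) by exact: continuous_compact.
    have /ex_strict_bound_gt0[M M0 fM] := compact_bounded cfA.
    by exists M; split=> // u Au; apply/ltW/fM; exists u.
  have [g [fg cg _]] := continuous_bounded_extension
    (@pseudometric_normal R V) clA M0 cf fM.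
  by exists g; split=> // u Au; rewrite -fg ?inE.
have /choice[g gP] := ext.
pose H0 u : 'rV[R]_n := \row_i g i u.
have cH0 : continuous H0.
  apply: continuous_row => i; have -> : (fun u => H0 u ord0 i) = g i.
    by apply/funext => u; rewrite mxE.
  by have [] := gP i.
have H0h u : A u -> H0 u = h u.
  by move=> Au; apply/rowP => i; rewrite mxE; apply: (gP i).2.
exists (fun u => 2^-1 *: (H0 u - H0 (- u))); split=> [u|u|u Au].
- apply: cvgZr; apply: cvgB; first exact: cH0.
  by apply: continuous_comp; [exact: opp_continuous|exact: cH0].
- by rewrite opprK -scalerN opprB.
- rewrite !H0h ?oddh ?opprK//; last exact: sA.
  by rewrite -[X in X + _]scale1r -[X in _ + X]scale1r -scalerDl scalerA mulVf
    ?scale1r// pnatr_eq0.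
Qed.

End symmetric_sets.

Section genus_theory.
Context (R : realType) (V : normedModType R).
Implicit Types A : set V.

Lemma genus_le A n (h : V -> 'rV[R]_n) : {within A, continuous h} ->
  (forall u, A u -> h u <> 0) -> (forall u, A u -> h (- u) = - h u) ->
  (genus A <= n%:R%:E)%E.
Proof.
move=> ch h0 hodd; rewrite /genus; case: asboolP => _; first by rewrite lee_fin.
by apply: ereal_inf_lbound; exists n => //; exists h.
Qed.

Lemma genus_ltP A l : (genus A < l%:R%:E)%E -> exists n (h : V -> 'rV[R]_n),
  [/\ (n < l)%N, {within A, continuous h}, forall u, A u -> h u <> 0 &
    forall u, A u -> h (- u) = - h u].
Proof.
rewrite /genus; case: asboolP => [->|_].
  rewrite lte_fin ltr0n => l0; exists 0%N, (fun=> 0); split=> //.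
  exact: continuous_subspace0.
move=> /ereal_inf_lt[_ [n [h [ch h0 hodd]] <-]].
by rewrite lte_fin ltr_nat => nl; exists n, h; split.
Qed.

Lemma continuous_finite_set (T : topologicalType) (f : V -> T) A :
  finite_set A -> {within A, continuous f}.
Proof.
move=> /finite_seqP[s ->]; elim: s => [|x s IH].
  by rewrite set_nil; exact: continuous_subspace0.
have -> : [set` x :: s] = [set x] `|` [set` s].
  by apply/seteqP; split=> y /=; rewrite inE => /predU1P.
apply: withinU_continuous => //.
- by apply: compact_closed_normed; exact: compact_set1.
- by apply: compact_closed_normed; exact/finite_compact/finite_seq.
- exact: continuous_subspace1.
Qed.

(** An odd sign separates [u] from [- u]: list the points of [A] and give 1 to whichever of the two
    comes first. Every map on a finite set is continuous. *)
Lemma finite_genus_le1 A : finite_set A -> symmetric_set A ->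
  A `<=` [set u | u != 0] -> (genus A <= 1%:E)%E.
Proof.
move=> fA; have /finite_seqP[s As] := fA; move=> /symmetric_setP sA A0.
pose f u : R := if (index u s < index (- u) s)%N then 1 else -1.
pose h u : 'rV[R]_1 := f u *: const_mx 1.
apply: (@genus_le A 1 h).
- exact: continuous_finite_set.
- move=> u Au /rowP/(_ ord0)/eqP; rewrite !mxE mulr1 /f.
  by case: ifPn => _; rewrite ?oppr_eq0 oner_eq0.
- move=> u Au; rewrite /h -scaleNr; congr (_ *: _); rewrite /f opprK.
  have us : u \in s by move: Au; rewrite As.
  have us' : - u \in s by move: (sA _ Au); rewrite As.
  case: ltngtP => [||e]; rewrite ?opprK//.
  (* Equal indices would mean [u = - u], hence [u = 0]. *)
  have uNu : u = - u by rewrite -[LHS](nth_index 0 us) -e nth_index.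
  have /eqP[] := A0 u Au; have : 2 *: u = 0.
    by rewrite scaler_nat mulr2n {2}uNu subrr.
  by move/eqP; rewrite scaler_eq0 pnatr_eq0 => /eqP.
Qed.

End genus_theory.

(** * Critical points of a compact convex quadratic-homogeneous energy *)

Lemma near_infty_invSn_le (R : realType) (e : R) : 0 < e ->
  exists N : nat, forall n, (N <= n)%N -> n.+1%:R^-1 <= e.
Proof.
move=> e0; exists (Num.truncn e^-1) => n Nn.
rewrite -[leRHS]invrK lef_pV2 ?posrE ?invr_gt0//.
by apply/ltW/(lt_le_trans (truncnS_gt _)); rewrite ler_nat.
Qed.


(** Lets [t] tend to 0 after an inequality along a segment has been divided by [t]. The value
    [e / (e + c)] stays in (0, 1] even when [c = 0]. *)
Lemma ler_small_perturbation (R : realType) (x y c : R) : 0 <= c ->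
  (forall t, 0 < t <= 1 -> x <= y + t * c) -> x <= y.
Proof.
move=> c0 xy; apply/ler_addgt0Pr => e e0.
have e1 : 0 < e + c by lra.
apply: (le_trans (xy (e / (e + c)) _)).
  by rewrite divr_gt0//= ler_pdivrMr//; lra.
rewrite lerD2l mulrAC ler_pdivrMr//; nra.
Qed.

Section inner_product.
Context (R : realType) (V : normedModType R) (ip : V -> V -> R).
Hypotheses (ipC : forall u v, ip u v = ip v u)
  (ipDl : forall u v w, ip (u + v) w = ip u w + ip v w)
  (ipZl : forall a u v, ip (a *: u) v = a * ip u v)
  (ipxx : forall u, ip u u = `|u| ^+ 2).

Lemma ipDr u v w : ip u (v + w) = ip u v + ip u w.
Proof. by rewrite !(ipC u) ipDl. Qed.

Lemma ipZr a u v : ip u (a *: v) = a * ip u v.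
Proof. by rewrite !(ipC u) ipZl. Qed.

Lemma ipNl u v : ip (- u) v = - ip u v.
Proof. by rewrite -scaleN1r ipZl mulN1r. Qed.

Lemma ipNr u v : ip u (- v) = - ip u v.
Proof. by rewrite !(ipC u) ipNl. Qed.

Lemma ip_normD u v : `|u + v| ^+ 2 = `|u| ^+ 2 + 2 * ip u v + `|v| ^+ 2.
Proof. by rewrite -!ipxx ipDl !ipDr (ipC v u); ring. Qed.

Lemma ip_le_norm u v : ip u v <= `|u| * `|v|.
Proof.
have [->|u0] := eqVneq u 0.
  by rewrite -(scale0r (0 : V)) ipZl mul0r scale0r normr0 mul0r.
have [->|v0] := eqVneq v 0.
  by rewrite -(scale0r (0 : V)) ipZr mul0r scale0r normr0 mulr0.
have uv0 : 0 < `|u| * `|v| by rewrite mulr_gt0 ?normr_gt0.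
have := sqr_ge0 `| `|v| *: u - `|u| *: v|.
rewrite ip_normD ipZl ipNr ipZr normrN !normrZ !normr_id => h.
rewrite -subr_ge0 -(pmulr_rge0 _ uv0) -(pmulr_rge0 _ (ltr0Sn R 1)).
by apply: le_trans h _; rewrite le_eqVlt; apply/orP; left; apply/eqP; ring.
Qed.

Lemma normr_ip u v : `|ip u v| <= `|u| * `|v|.
Proof.
by rewrite ler_norml ip_le_norm andbT lerNl -ipNl -(normrN u) ip_le_norm.
Qed.

Lemma ip_continuous w : continuous (ip ^~ w).
Proof.
move=> u; apply/cvgrPdist_le => e e0; near=> v.
rewrite -ipNl -ipDl (le_trans (normr_ip _ _))//.
have w1 : 0 < `|w| + 1 by rewrite ltr_wpDl.
apply: (@le_trans _ _ (e / (`|w| + 1) * (`|w| + 1))); last by rewrite divfK ?gt_eqF.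
apply: ler_pM => //; last by rewrite lerDl.
near: v; apply: cvgr_dist_le => //; exact: divr_gt0.
Unshelve. all: by end_near. Qed.

(* Homogeneity and convexity are stated on sublevels, where [F] is finite. *)
Context (F : V -> \bar R).
Hypotheses (F_ge0 : forall u, (0 <= F u)%E)
  (FZ : forall c u a, (F u <= a%:E)%E -> (F (c *: u) <= (c ^+ 2 * a)%:E)%E)
  (F_convex : forall (t : R) u v a b, 0 <= t <= 1 ->
     (F u <= a%:E)%E -> (F v <= b%:E)%E ->
     (F (t *: u + (1 - t) *: v)%R <= (t * a + (1 - t) * b)%:E)%E)
  (F_compact : forall M : R, 0 < M -> compact [set u | `|u| <= 1 /\ (F u <= M%:E)%E]).

Lemma energy_bound_ge0 u a : (F u <= a%:E)%E -> 0 <= a.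
Proof. by move=> /(le_trans (F_ge0 u)); rewrite lee_fin. Qed.

Lemma energyN u a : (F u <= a%:E)%E -> (F (- u)%R <= a%:E)%E.
Proof. by move/(FZ (-1)); rewrite scaleN1r sqrrN expr1n mul1r. Qed.

(** Compactness is assumed at positive levels only, so the level [c], possibly 0, is obtained as the
    intersection of the levels [c + e]. *)
Lemma closed_energy_level c : 0 <= c ->
  closed [set u | `|u| <= 1 /\ (F u <= c%:E)%E].
Proof.
move=> c0.
have -> : [set u | `|u| <= 1 /\ (F u <= c%:E)%E] =
    \bigcap_(e in [set e : R | 0 < e]) [set u | `|u| <= 1 /\ (F u <= (c + e)%:E)%E].
  apply/seteqP; split=> [u [u1 uc] e /= e0|u uc].
    by split=> //; apply: (le_trans uc); rewrite lee_fin lerDl ltW.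
  split; first by have [] := uc 1 ltr01.
  apply/lee_addgt0Pr => e e0; rewrite -EFinD.
  by have [] := uc e e0.
apply: closed_bigI => e e0; apply: compact_closed_normed.
by apply: F_compact; rewrite ltr_wpDl.
Qed.

(* The ball [|v|^2 + F v <= 1], with [F v] isolated to avoid extended-real
   arithmetic. *)
Definition graph_ball : set V := [set v | (F v <= (1 - `|v| ^+ 2)%:E)%E].

Lemma graph_ball_norm v : graph_ball v -> `|v| <= 1.
Proof.
move=> /energy_bound_ge0; rewrite subr_ge0 => h.
by rewrite -(@ler_pXn2r _ 2) ?nnegrE// expr1n.
Qed.

Lemma graph_ballN v : graph_ball v -> graph_ball (- v).
Proof. by rewrite /graph_ball /= normrN; exact: energyN. Qed.

Lemma graph_ball_scale k w b : 0 < k -> (F w <= b%:E)%E ->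
  `|w| ^+ 2 + b <= k ^+ 2 -> graph_ball (k^-1 *: w).
Proof.
move=> k0 wb h; rewrite /graph_ball /=; apply: (le_trans (FZ k^-1 wb)).
rewrite lee_fin normrZ exprMn gtr0_norm ?invr_gt0// exprVn.
rewrite -(ler_pM2l (exprn_gt0 2 k0)) mulrBr !mulrA divff ?gt_eqF ?exprn_gt0//.
by rewrite mulr1 !mul1r lerBrDr addrC.
Qed.

(** Near [v], continuity of the norm places the points of the ball in the closed sublevel of height
    [1 - |v|^2 + e], so [v] lies in it as well; then [e] tends to 0. *)
Lemma closed_graph_ball : closed graph_ball.
Proof.
move=> v clv; rewrite /graph_ball /=; apply/lee_addgt0Pr => e e0.
rewrite -EFinD; set c := 1 - `|v| ^+ 2 + e.
have near_norm : \forall w \near v, `|v| ^+ 2 - e <= `|w| ^+ 2.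
  have : (fun w : V => `|w| ^+ 2) w @[w --> v] --> (`|v| ^+ 2).
    by apply: cvgM; exact: cvg_norm.
  move/cvgrPdist_le => /(_ e e0); apply: filterS => w; rewrite ler_norml; lra.
have inc w : graph_ball w -> `|v| ^+ 2 - e <= `|w| ^+ 2 ->
    `|w| <= 1 /\ (F w <= c%:E)%E.
  move=> bw vw; split; first exact: graph_ball_norm.
  by apply: (le_trans bw); rewrite lee_fin /c; lra.
have [w0 [bw0 vw0]] := clv _ near_norm.
have c0 : 0 <= c by have [_ /energy_bound_ge0] := inc w0 bw0 vw0.
suff [] : `|v| <= 1 /\ (F v <= c%:E)%E by [].
apply: (closed_energy_level c0) => U vU.
have [w [bw [Uw vw]]] := clv _ (filterI vU near_norm).
by exists w; split=> //; exact: inc.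
Qed.

Lemma compact_graph_ball : compact graph_ball.
Proof.
apply: (subclosed_compact closed_graph_ball (F_compact ltr01)) => v bv.
split; first exact: graph_ball_norm.
by apply: (le_trans bv); rewrite lee_fin gerBl sqr_ge0.
Qed.

(** * Support points of the graph ball *)

Definition dual_max u v :=
  graph_ball v /\ forall w, graph_ball w -> ip u w <= ip u v.

Lemma dual_max_exists u u0 a : (F u0 <= a%:E)%E -> exists v, dual_max u v.
Proof.
move=> Fu0; have [||v] := compact_EVT_max _ compact_graph_ball _ (f := ip u).
- exists 0; rewrite /graph_ball /= normr0 expr0n subr0 -(scale0r u0).
  by apply: (le_trans (FZ 0 Fu0)); rewrite expr0n mul0r lee_fin.
- apply: continuous_subspaceT => w.
  have -> : ip u = ip ^~ u by apply/funext => x; exact: ipC.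
  exact: ip_continuous.
- rewrite inE => bv vmax; exists v; split=> // w bw.
  by apply: vmax; rewrite inE.
Qed.

Lemma dual_max_le u v w k b : dual_max u v -> 0 < k -> (F w <= b%:E)%E ->
  `|w| ^+ 2 + b <= k ^+ 2 -> ip u w <= k * ip u v.
Proof.
move=> [_ vmax] k0 wb /(graph_ball_scale k0 wb)/vmax.
by rewrite ipZr ler_pdivrMl.
Qed.

(** Maximality is tested with [u] divided by [1 + a], which lies in the ball because
    [1 + a <= (1 + a)^2]; this gives [1 <= (1 + a) * ip u v]. *)
Lemma dual_max_gt0 u v a : `|u| = 1 -> (F u <= a%:E)%E -> dual_max u v ->
  0 < ip u v.
Proof.
move=> u1 Fu uv; have a0 := energy_bound_ge0 Fu.
have a1 : 0 < 1 + a by lra.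
have := @dual_max_le u v u (1 + a) a uv a1 Fu.
rewrite ipxx u1 expr1n => /(_ ltac:(nra)) h.
by rewrite -(pmulr_rgt0 _ a1); lra.
Qed.

(* Convexity of the energy makes the graph ball uniformly convex, so its
   support points depend Hoelder-continuously on the functional. *)
Lemma dual_max_stable u1 u2 v1 v2 : dual_max u1 v1 -> dual_max u2 v2 ->
  `|v1 - v2| ^+ 2 * ip u1 v1 <= 8 * `|u1 - u2|.
Proof.
move=> m1 m2; have [b1 max1] := m1; have [b2 max2] := m2.
have n1 := graph_ball_norm b1; have n2 := graph_ball_norm b2.
set D := `|v1 - v2| ^+ 2; set s := ip u1 v1.
have D4 : D <= 4.
  have : `|v1 - v2| <= 2 by apply: (le_trans (ler_normB _ _)); lra.
  by have := normr_ge0 (v1 - v2); rewrite /D; nra.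
have DE : D = `|v1| ^+ 2 - 2 * ip v1 v2 + `|v2| ^+ 2.
  by rewrite /D ip_normD normrN ipNr; ring.
(* By the parallelogram identity [|mid|^2 + F mid <= 1 - D / 4 <= (1 - D / 8)^2], so [mid] lies in
   the ball shrunk by [1 - D / 8], a positive factor since [D <= 4]. *)
set mid := 2^-1 *: v1 + (1 - 2^-1) *: v2.
have Fmid := @F_convex 2^-1 v1 v2 _ _ ltac:(lra) b1 b2.
have midE : `|mid| ^+ 2 = 2^-1 * `|v1| ^+ 2 + 2^-1 * `|v2| ^+ 2 - 4^-1 * D.
  rewrite /mid ip_normD ipZl ipZr !normrZ !exprMn !real_normK ?num_real// DE.
  by field.
have D0 : 0 <= D by exact: sqr_ge0.
have := @dual_max_le u1 v1 mid (1 - D / 8) _ m1 ltac:(lra) Fmid.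
rewrite midE => /(_ ltac:(nra)); rewrite /mid ipDr !ipZr -/s.
(* Replace [u1] by [u2], use that [v2] is optimal for [u2], and go back to [u1]: each exchange costs
   [|u1 - u2|]. *)
have : ip u1 v2 >= s - 2 * `|u1 - u2|.
  have h (w : V) : `|w| <= 1 -> `|ip (u1 - u2) w| <= `|u1 - u2|.
    by move=> w1; apply: (le_trans (normr_ip _ _)); rewrite ler_piMr.
  have := h _ n1; have := h _ n2; have := max2 _ b1.
  by rewrite !ipDl !ipNl !ler_norml -/s; lra.
lra.
Qed.

Lemma dual_max_unique u v1 v2 a : `|u| = 1 -> (F u <= a%:E)%E ->
  dual_max u v1 -> dual_max u v2 -> v1 = v2.
Proof.
move=> u1 Fu m1 m2; have := dual_max_stable m1 m2.
rewrite subrr normr0 mulr0 pmulr_lle0 ?(dual_max_gt0 u1 Fu m1)//.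
rewrite le_eqVlt ltNge sqr_ge0 orbF sqrf_eq0 normr_eq0 subr_eq0.
by move/eqP.
Qed.

Lemma dual_maxN u v : dual_max u v -> dual_max (- u) (- v).
Proof.
move=> [bv vmax]; split=> [|w bw]; first exact: graph_ballN.
by rewrite ipNl ipNl ipNr opprK -ipNr; apply/vmax/graph_ballN.
Qed.


(** For [|u| = 1] the inequality reads [F v >= lam + 2 <lam u, v - u>]: twice the statement that
    [lam *: u] is a subgradient of [F / 2] at [u]. Real bounds [b] stand for [F v] to stay within
    the reals. *)
Definition critical_point lam u := [/\ `|u| = 1, (F u <= lam%:E)%E &
  forall v b, (F v <= b%:E)%E -> lam + 2 * lam * (ip u v - 1) <= b].

(** The case [v = u] of the subgradient inequality supplies the lower bound. *)
Lemma critical_point_energy lam u : critical_point lam u -> F u = lam%:E.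
Proof.
move=> [u1 Fu crit]; apply/eqP; rewrite eq_le Fu /=.
have := F_ge0 u; move: Fu (crit u).
case: (F u) => [r| |] // _ /(_ r (lexx _)).
by rewrite ipxx u1 expr1n subrr mulr0 addr0 lee_fin.
Qed.

Lemma critical_pointN lam u : critical_point lam u -> critical_point lam (- u).
Proof.
move=> [u1 Fu crit]; split; first by rewrite normrN.
  exact: energyN.
by move=> v b /energyN/crit; rewrite ipNr ipNl.
Qed.

Lemma compact_critical_point lam : 0 <= lam -> compact (critical_point lam).
Proof.
move=> lam0; have lam1 : 0 < lam + 1 by lra.
apply: (subclosed_compact _ (F_compact lam1)); last first.
  move=> u [u1 Fu _]; split; first by rewrite u1.
  by apply: (le_trans Fu); rewrite lee_fin lerDl.
have -> : critical_point lam = [set u | `|u| = 1] `&`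
    ([set u | `|u| <= 1 /\ (F u <= lam%:E)%E] `&`
     \bigcap_(vb in [set vb : V * R | (F vb.1 <= vb.2%:E)%E])
       [set u | lam + 2 * lam * (ip u vb.1 - 1) <= vb.2]).
  apply/seteqP; split=> [u [u1 Fu crit]|u [u1 [[_ Fu] crit]]].
    by split=> //; split=> [|[v b] /crit//]; split; rewrite //= u1.
  by split=> // v b Fv; exact: (crit (v, b)).
apply: closedI.
  apply: (@closed_comp _ _ (fun u : V => `|u|) [set 1]) => [u _|].
    exact: norm_continuous.
  exact: closed_eq.
apply: closedI; first exact: closed_energy_level.
apply: closed_bigI => -[v b] _ /=.
apply: (@closed_comp _ _ (fun u : V => lam + 2 * lam * (ip u v - 1)) [set x | x <= b]).
  move=> u _; apply: cvgD; first exact: cvg_cst.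
  apply: cvgM; first exact: cvg_cst.
  by apply: cvgB; [exact: ip_continuous|exact: cvg_cst].
exact: closed_le.
Qed.

(* Differentiate the inequality [(1 + lam) <u, v>^2 <= |v|^2 + F v] along the
   segment from [u] to [v]; it is an equality at [u]. *)
Lemma critical_point_of_dual lam u : 0 <= lam -> `|u| = 1 ->
  (F u <= lam%:E)%E ->
  (forall w, graph_ball w -> (1 + lam) * ip u w ^+ 2 <= 1) ->
  critical_point lam u.
Proof.
move=> lam0 u1 Fu ball_le.
(* By homogeneity the bound on the graph ball extends to every [v] of finite energy; the scaling
   factor can vanish only for [v = 0]. *)
have quad v b : (F v <= b%:E)%E -> (1 + lam) * ip u v ^+ 2 <= `|v| ^+ 2 + b.
  move=> Fv; have b0 := energy_bound_ge0 Fv.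
  have [c0|c0] := ltP 0 (`|v| ^+ 2 + b).
    have k0 : 0 < Num.sqrt (`|v| ^+ 2 + b) by rewrite sqrtr_gt0.
    have := ball_le _ (graph_ball_scale k0 Fv _).
    rewrite sqr_sqrtr ?(ltW c0)// ipZr exprMn exprVn sqr_sqrtr ?(ltW c0)//.
    by move=> /(_ (lexx _)); rewrite mulrCA ler_pdivrMl// mulr1.
  have v0 : v = 0.
    apply/eqP; rewrite -normr_eq0 -sqrf_eq0 eq_le sqr_ge0 andbT; lra.
  by rewrite v0 -(scale0r u) ipZr mul0r expr0n mulr0 addr_ge0 ?sqr_ge0.
split=> // v b Fv; set z := v - u; set p := ip u z; set q := `|z| ^+ 2.
have q0 : 0 <= q by exact: sqr_ge0.
have -> : ip u v - 1 = p by rewrite /p /z ipDr ipNr ipxx u1 expr1n.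
(* The error [q] is the coefficient of [t^2] in [|u + t z|^2]. *)
apply: (@ler_small_perturbation _ _ _ q q0) => t /andP[t0 t1].
have := quad _ _ (@F_convex t v u _ _ ltac:(lra) Fv Fu).
have -> : t *: v + (1 - t) *: u = u + t *: z.
  by rewrite /z scalerBl scale1r scalerBr addrCA.
rewrite ipDr ipxx ip_normD u1 !expr1n !ipZr normrZ exprMn real_normK ?num_real//.
rewrite -/p -/q => h; rewrite -(ler_pM2l t0).
have := sqr_ge0 (t * p); nra.
Qed.

Lemma dual_max_energy u v a : `|u| = 1 -> (F u <= a%:E)%E -> dual_max u v ->
  0 < `|v| /\ (F (`|v|^-1 *: v) <= (`|v|^-1 ^+ 2 * (1 - `|v| ^+ 2))%:E)%E.
Proof.
move=> u1 Fu uv; split; last by apply: FZ; exact: uv.1.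
by have := ip_le_norm u v; rewrite u1 mul1r; apply/lt_le_trans/(dual_max_gt0 u1 Fu).
Qed.

(** If no [e] of the form 1/(n+1) worked, there would be unit vectors of [Z] with energy at most
    [lam + e] and [(1 + lam - e) * s^2 <= 1], where [s] is the maximum of [ip u] on the ball. A
    cluster point of these is critical by [critical_point_of_dual] and lies in [Z]. *)
Lemma energy_drop lam (Z : set V) : 0 <= lam -> closed Z ->
  critical_point lam `&` Z = set0 ->
  exists2 e, 0 < e & forall u v, `|u| = 1 -> Z u -> (F u <= (lam + e)%:E)%E ->
    dual_max u v -> (F (`|v|^-1 *: v) <= (lam - e)%:E)%E.
Proof.
move=> lam0 clZ critZ.
pose D (e : R) u := [/\ `|u| = 1, Z u, (F u <= (lam + e)%:E)%E &
  forall w, graph_ball w -> (1 + lam - e) * ip u w ^+ 2 <= 1].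
have [[n /forallNP Dn]|nD] := pselect (exists n : nat, ~ exists u, D n.+1%:R^-1 u).
  exists n.+1%:R^-1; first by rewrite invr_gt0.
  move=> u v u1 Zu Fu uv; set e := n.+1%:R^-1 in Dn Fu *.
  have [v0 Fv] := dual_max_energy u1 Fu uv.
  apply: (le_trans Fv); rewrite lee_fin.
  have v20 : 0 < `|v| ^+ 2 by rewrite exprn_gt0.
  rewrite exprVn mulrBr mulVf ?gt_eqF// mulr1.
  (* This is [1 / |v|^2 - 1 <= lam - e] without denominators. Its failure would give [D e u], as
     [(ip u w)^2 <= |v|^2] on the ball. *)
  suff : 1 <= (1 + lam - e) * `|v| ^+ 2.
    by rewrite -ler_pdivrMr// mul1r; lra.
  rewrite leNgt; apply/negP => lt1; apply: (Dn u); split=> // w bw.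
  have uw : ip u w ^+ 2 <= `|v| ^+ 2.
    have uv1 := uv.2 _ bw; have uv2 := uv.2 _ (graph_ballN bw).
    have := ip_le_norm u v; rewrite ipNr u1 mul1r in uv2 *.
    by nra.
  have [c0|c0] := leP 0 (1 + lam - e).
    by apply: le_trans (ltW lt1); rewrite ler_wpM2l.
  by apply: le_trans ler01; rewrite nmulr_rle0 ?sqr_ge0.
have /choice[u_ uD] : forall n : nat, exists u, D n.+1%:R^-1 u.
  by move=> n; apply: contrapT => nDn; apply: nD; exists n.
pose C := [set u | `|u| <= 1 /\ (F u <= (lam + 1)%:E)%E].
have inv1 n : n.+1%:R^-1 <= 1 :> R by rewrite invf_le1 ?ler1n.
have Cu n : C (u_ n).
  have [u1 _ Fu _] := uD n; split; first by rewrite u1.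
  by apply: (le_trans Fu); rewrite lee_fin lerD2l.
have lam1 : 0 < lam + 1 by lra.
have [u [_ clu]] : C `&` cluster (u_ @ \oo) !=set0.
  by apply: (F_compact lam1); exists 0%N => // n _; exact: Cu.
(* A closed condition that holds for all large [n] passes to the cluster point. *)
have clD (A : set V) : closed A -> (exists N : nat, forall n, (N <= n)%N -> A (u_ n)) -> A u.
  move=> clA [N An]; apply: clA => B uB.
  by apply: clu => //; exists N.
have u1 : `|u| = 1.
  apply: (clD [set u | `|u| = 1]).
    apply: (@closed_comp _ _ (fun u : V => `|u|) [set 1]) => [x _|].
      exact: norm_continuous.
    exact: closed_eq.
  by exists 0%N => n _; case: (uD n).
have Zu : Z u by apply: clD => //; exists 0%N => n _; case: (uD n).
suff : (critical_point lam `&` Z) u by rewrite critZ.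
split=> //; apply: critical_point_of_dual => //.
  apply/lee_addgt0Pr => e e0; rewrite -EFinD.
  have le0 : 0 <= lam + e by lra.
  apply: (clD _ (closed_energy_level le0) _).2.
  have [N Ne] := near_infty_invSn_le e0; exists N => n /Ne ne; have [v1 _ Fv _] := uD n.
  by split; [rewrite v1|apply: (le_trans Fv); rewrite lee_fin lerD2l].
move=> w bw; apply/ler_addgt0Pr => e e0.
have uw1 : ip u w ^+ 2 <= 1.
  have := normr_ip u w; have := graph_ball_norm bw; rewrite u1 mul1r => w1 uw.
  by rewrite -real_normK ?num_real// expr_le1// (le_trans uw).
suff : (1 + lam - e) * ip u w ^+ 2 <= 1 by nra.
apply: (clD [set x | (1 + lam - e) * ip x w ^+ 2 <= 1]).
  apply: (@closed_comp _ _ (fun x : V => (1 + lam - e) * ip x w ^+ 2) [set y | y <= 1]).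
    move=> x _; apply: cvgM; first exact: cvg_cst.
    by apply: cvgM; exact: ip_continuous.
  exact: closed_le.
have [N Ne] := near_infty_invSn_le e0; exists N => n /Ne ne; have [_ _ _ /(_ w bw)] := uD n.
by apply: le_trans; rewrite ler_wpM2r ?sqr_ge0// lerD2l lerN2.
Qed.

(* Meaningful only if [F] is finite somewhere; otherwise [xget] returns [0]. *)
Definition normalized_dual u : V :=
  let v := xget 0 (dual_max u) in `|v|^-1 *: v.

Lemma xget_dual_max u a : (F u <= a%:E)%E -> dual_max u (xget 0 (dual_max u)).
Proof.
move=> Fu; have [v uv] := dual_max_exists u Fu.
exact: (@xgetI V 0 (dual_max u) v uv).
Qed.

Lemma normalized_dual_sphere u a : `|u| = 1 -> (F u <= a%:E)%E ->
  `|normalized_dual u| = 1.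
Proof.
move=> u1 Fu; have [v0 _] := dual_max_energy u1 Fu (xget_dual_max Fu).
by rewrite normrZ gtr0_norm ?invr_gt0// mulVf ?gt_eqF.
Qed.

(** Uniqueness of the support point makes the choice by [xget] odd. *)
Lemma normalized_dualN u a : `|u| = 1 -> (F u <= a%:E)%E ->
  normalized_dual (- u) = - normalized_dual u.
Proof.
move=> u1 Fu; rewrite /normalized_dual.
have -> : xget 0 (dual_max (- u)) = - xget 0 (dual_max u).
  have Nu1 : `|- u| = 1 by rewrite normrN.
  apply: (dual_max_unique Nu1 (energyN Fu)); first exact/xget_dual_max/energyN/Fu.
  exact/dual_maxN/xget_dual_max/Fu.
by rewrite normrN scalerN.
Qed.

Lemma continuous_normalized_dual (A : set V) a :
  (forall u, A u -> `|u| = 1 /\ (F u <= a%:E)%E) ->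
  {within A, continuous normalized_dual}.
Proof.
move=> As; pose d u := xget 0 (dual_max u).
have cd : {within A, continuous d}.
  rewrite continuous_subspace_in => u; rewrite inE => Au.
  have [u1 Fu] := As _ Au; have du := xget_dual_max Fu.
  have s0 := dual_max_gt0 u1 Fu du.
  apply/cvgrPdist_le => e e0; rewrite -nbhs_subspace_in//.
  (* Within this distance [8 * |u - w| <= e^2 * ip u (d u)], so [dual_max_stable] keeps the support
     points [e]-close. *)
  have d0 : 0 < e ^+ 2 * ip u (d u) / 8 by rewrite divr_gt0// mulr_gt0// exprn_gt0.
  have : \forall w \near u, `|u - w| <= e ^+ 2 * ip u (d u) / 8.
    exact: cvgr_dist_le.
  apply: filterS => w uw Aw /=; have [w1 Fw] := As _ Aw.
  have := dual_max_stable du (xget_dual_max Fw) => h.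
  rewrite -(@ler_pXn2r _ 2) ?nnegrE ?(ltW e0)// -(ler_pM2r s0).
  by apply: (le_trans h); rewrite -ler_pdivlMl// mulrC.
rewrite continuous_subspace_in => u; rewrite inE => Au.
have [u1 Fu] := As _ Au; have [v0 _] := dual_max_energy u1 Fu (xget_dual_max Fu).
apply: cvgZ; last exact: cd.
apply: cvgV; first by rewrite gt_eqF.
by apply: cvg_norm; exact: cd.
Qed.

Lemma genus_critical_point lam k l : 0 <= lam -> (1 <= k)%N -> (1 <= l)%N ->
  minmax F k = lam%:E -> minmax F (k + l - 1) = lam%:E ->
  (l%:R%:E <= genus (critical_point lam))%E.
Proof.
move=> lam0 k1 l1 minmaxk minmaxl; rewrite leNgt; apply/negP => /genus_ltP.
move=> [n [h [nl ch h0 hodd]]].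
have [|H [cH Hodd Hh]] := odd_extension (compact_critical_point lam0) _ ch hodd.
  by apply/symmetric_setP => u; exact: critical_pointN.
pose Z := [set u | H u = 0].
have clZ : closed Z.
  apply: (@closed_comp _ _ H [set 0]) => [u _|]; first exact: cH.
  by apply: compact_closed_normed; exact: compact_set1.
(* [H] equals [h] on the critical set and so has no zero there. *)
have [|e e0 drop] := energy_drop lam0 clZ.
  by apply/seteqP; split=> // u [Ku]; rewrite /Z /= Hh// => /(h0 _ Ku).
have : (minmax F (k + l - 1) < (lam + e)%:E)%E by rewrite minmaxl lte_fin ltrDl.
move=> /ereal_inf_lt[_ [A [cA sA A1 gA] <-] supA].
have FA u : A u -> (F u <= (lam + e)%:E)%E.
  move=> Au; apply: le_trans (ltW supA).
  by apply: ereal_sup_ubound; exists u.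
pose A0 := A `&` Z.
have A0P u : A0 u -> `|u| = 1 /\ (F u <= (lam + e)%:E)%E.
  by move=> [Au _]; split; [exact: A1|exact: FA].
have cA0 : compact A0 by apply: compact_closedI.
have sA' := (symmetric_setP _).1 sA.
have sA0 : symmetric_set A0.
  apply/symmetric_setP => u [Au Zu]; split; first exact: sA'.
  by rewrite /Z /= Hodd Zu oppr0.
have cr := continuous_normalized_dual A0P.
have cB : compact (normalized_dual @` A0) by exact: continuous_compact.
have sB : symmetric_set (normalized_dual @` A0).
  apply/symmetric_setP => _ [u Au <-]; have [u1 Fu] := A0P _ Au.
  by exists (- u); [exact: (symmetric_setP _).1 sA0 _ Au|exact: (normalized_dualN u1 Fu)].
(* Otherwise this image would compete for [minmax F k], with all its energies at most [lam - e]. *)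
have : (genus (normalized_dual @` A0) < k%:R%:E)%E.
  rewrite ltNge; apply/negP => gB.
  have : (minmax F k <= (lam - e)%:E)%E.
    apply: (@le_trans _ _ (ereal_sup [set F u | u in normalized_dual @` A0])).
      apply: ereal_inf_lbound; exists (normalized_dual @` A0) => //; split=> //.
      by move=> _ [u Au <-]; have [u1 Fu] := A0P _ Au; exact: (normalized_dual_sphere u1 Fu).
    apply: ge_ereal_sup => _ [_ [u Au <-] <-]; have [u1 Fu] := A0P _ Au.
    by apply: (drop _ _ u1 Au.2 Fu); exact: xget_dual_max Fu.
  by rewrite minmaxk lee_fin; lra.
move=> /genus_ltP[j [g [jk cg g0 godd]]].
have [G [cG Godd Gg]] := odd_extension cB sB cg godd.
(* Continuity and oddness of [normalized_dual] are known on [A0] only, so the composite is extended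
   once more to the whole space. *)
have [||G' [cG' G'odd G'G]] :=
    odd_extension (h := G \o normalized_dual) cA0 sA0.
- move=> u; apply: (@continuous_comp (subspace A0) _ _ normalized_dual G).
    exact: cr.
  exact: cG.
- move=> u Au; have [u1 Fu] := A0P _ Au.
  by rewrite /= (normalized_dualN u1 Fu) Godd.
move: gA; rewrite leNgt => /negP; apply.
(* At points of [A] where [H] vanishes, [G'] equals [g] after [normalized_dual] and is nonzero. As
   [j <= k - 1] and [n <= l - 1], the dimension [j + n] is below [k + l - 1]. *)
apply: (@le_lt_trans _ _ ((j + n)%:R%:E)).
  apply: (@genus_le _ _ _ _ (fun u => row_mx (G' u) (H u))).
  - apply: continuous_subspaceT; apply: continuous_row => i.
    rewrite -(fintype.splitK i); case: (fintype.split i) => s /=.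
      under eq_fun do rewrite row_mxEl.
      by move=> x; apply: (@continuous_comp _ _ _ G' (fun M : 'rV[R]_j => M ord0 s));
        [exact: cG'|exact: coord_continuous].
    under eq_fun do rewrite row_mxEr.
    by move=> x; apply: (@continuous_comp _ _ _ H (fun M : 'rV[R]_n => M ord0 s));
        [exact: cH|exact: coord_continuous].
  - move=> u Au /eqP; rewrite row_mx_eq0 => /andP[/eqP G'u /eqP Hu].
    have A0u : A0 u by [].
    have Bu : (normalized_dual @` A0) (normalized_dual u) by exists u.
    by apply: (g0 _ Bu); rewrite -Gg// -[LHS]G'G.
  - by move=> u _; rewrite G'odd Hodd opp_row_mx.
rewrite lte_fin ltr_nat; lia.
Qed.

(** The condition [u != 0] makes the space nontrivial: the points [u + t u] show that [u] is not
    isolated, so the limsup of nonnegative quotients is nonnegative and not minus infinity. *)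
Lemma descending_slope_eq0P (f : V -> \bar R) u r : u != 0 -> f u = r%:E ->
  descending_slope f u = 0%E <->
  forall e, 0 < e -> \forall w \near u, (f u - f w <= (e * `|u - w|)%:E)%E.
Proof.
move=> u0 fu; split=> [slope0 e e0|fe].
  have : (descending_slope f u < e%:E)%E by rewrite slope0 lte_fin.
  move=> /ereal_inf_lt[_ [B uB <-] supB].
  have {}uB : \forall w \near u, w != u -> B w := uB.
  apply: filterS uB => w /= Bw.
  have [->|wu] := eqVneq w u; first by rewrite fu subee// subrr normr0 mulr0.
  have uw0 : 0 < `|u - w| by rewrite normr_gt0 subr_eq0 eq_sym.
  rewrite EFinM -lee_pdivrMr//.
  apply: le_trans (ltW supB); apply: le_trans; last first.
    by apply: ereal_sup_ubound; exists w => //; exact: Bw.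
  by rewrite lee_wpmul2r ?lee_fin ?invr_ge0// le_max lexx orbT.
apply/eqP; rewrite eq_le; apply/andP; split; last first.
  apply: limf_esup_ge0 => [|w]; last first.
    by rewrite mule_ge0 ?lee_fin ?invr_ge0// le_max lexx.
  rewrite /dnbhs /= => /nbhs_ballP[e /= e0 sub].
  have u_gt0 : 0 < `|u| by rewrite normr_gt0.
  pose t := e / (2 * `|u|).
  have t0 : 0 < t by rewrite divr_gt0// mulr_gt0.
  apply: (sub (u + t *: u)).
    rewrite -ball_normE /= opprD addNKr normrN normrZ gtr0_norm//.
    by rewrite /t invfM mulrA divfK ?gt_eqF// ltr_pdivrMr//; lra.
  by rewrite -subr_eq0 addrAC subrr add0r scaler_eq0 negb_or gt_eqF.
apply/lee_addgt0Pr => e e0; rewrite add0e.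
pose B := [set w | w != u /\ (f u - f w <= (e * `|u - w|)%:E)%E].
have uB : u^' B by rewrite /dnbhs; apply: filterS (fe e e0).
apply: (@le_trans _ _ (ereal_sup ((fun w =>
    Order.max 0%E (f u - f w) * (`|u - w|^-1)%:E)%E @` B))).
  by apply: ereal_inf_lbound; exists B.
apply: ge_ereal_sup => _ [w [wu fw] <-].
have uw0 : 0 < `|u - w| by rewrite normr_gt0 subr_eq0 eq_sym.
by rewrite lee_pdivrMr// -EFinM ge_max fw andbT lee_fin mulr_ge0// ltW.
Qed.

(** * The descending slope of the truncated energy *)

Section truncation.
Variables (lam L : R).

Let Phi u := if `[< `|u| <= 1 /\ (F u <= (lam + 1)%:E)%E >] then F u else +oo%E.
Let PhiL u := (Phi u - (L * `|u| ^+ 2)%:E)%E.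

Let PhiLE u : `|u| = 1 -> Phi u = lam%:E -> PhiL u = (lam - L)%:E.
Proof. by move=> u1 Phiu; rewrite /PhiL Phiu u1 expr1n mulr1. Qed.

(** Where [Phi] is finite, the subgradient inequality together with [|w| <= 1] bounds the decrease
    from [u] to [w] by [lam * |u - w|^2], which is of second order; elsewhere [PhiL] is infinite. *)
Lemma critical_point_slope u : 0 <= lam -> lam + 1 < L -> critical_point lam u ->
  Phi u = lam%:E /\ descending_slope PhiL u = 0%E.
Proof.
move=> lam0 lamL critu; have [u1 Fu crit] := critu; have Fulam := critical_point_energy critu.
have Phiu : Phi u = lam%:E.
  rewrite /Phi; case: asboolP => // -[]; split; first by rewrite u1.
  by rewrite Fulam lee_fin lerDl.
split=> //; apply/(descending_slope_eq0P _ (PhiLE u1 Phiu)).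
  by rewrite -normr_gt0 u1.
move=> e e0; rewrite (PhiLE u1 Phiu).
have L0 : 0 < L by lra.
have : \forall w \near u, `|u - w| <= e / L.
  by apply: cvgr_dist_le => //; exact: divr_gt0.
apply: filterS => w uwe; rewrite /PhiL /Phi; case: asboolP => [[w1 _]|_]; last first.
  by rewrite addye// addeNy leNye.
have := F_ge0 w; case Fw : (F w) => [b| |] // _; last first.
  by rewrite addye// addeNy leNye.
have := crit w b; rewrite Fw => /(_ (lexx _)).
rewrite -!EFinB lee_fin.
set d := `|u - w| in uwe *; set W := `|w| ^+ 2; set P := ip u w => h.
have W1 : W <= 1 by rewrite expr_le1.
have dE : d ^+ 2 = 1 - 2 * P + W.
  by rewrite /d ip_normD normrN ipNr u1 expr1n mulrN.
have d0 : 0 <= d by exact: normr_ge0.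
have Ld : L * d ^+ 2 <= e * d.
  by rewrite expr2 mulrA ler_wpM2r// mulrC -ler_pdivlMr.
have P1 : 0 <= 1 - P by have := sqr_ge0 d; lra.
by nra.
Qed.

(** Vanishing slope is applied along the segment from [u] to [w], which convexity keeps in the
    domain of [Phi], and the result is divided by [t]. The factor is [2 * L], the derivative of the
    quadratic term, and not yet [2 * lam]. *)
Let slope_segment u w b : 0 <= lam -> lam + 1 < L -> `|u| = 1 -> Phi u = lam%:E ->
  descending_slope PhiL u = 0%E -> `|w| <= 1 -> (F w <= b%:E)%E ->
  b <= lam + 1 -> lam + 2 * L * (ip u w - 1) <= b.
Proof.
move=> lam0 lamL u1 Phiu slope0 w1 Fw blam; have L0 : 0 < L by lra.
have Fu : (F u <= lam%:E)%E.
  by rewrite -Phiu /Phi; case: asboolP => // _; rewrite leey.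
have u0 : u != 0 by rewrite -normr_gt0 u1.
apply/ler_addgt0Pr => e e0; set z := w - u; set p := ip u w - 1.
have z1 : 0 < `|z| + 1 by rewrite ltr_wpDl.
have := (descending_slope_eq0P u0 (PhiLE u1 Phiu)).1 slope0 (e / (`|z| + 1)) (divr_gt0 e0 z1).
move=> /nbhs_ballP[d /= d0 ud]; rewrite (PhiLE u1 Phiu) in ud.
(* Chosen so that [t * |z| < d], which puts [u + t *: z] in the ball where the slope estimate
   holds. *)
pose t := Num.min 1 (d / (2 * (`|z| + 1))).
have z2 : 0 < 2 * (`|z| + 1) by rewrite mulr_gt0.
have t0 : 0 < t by rewrite lt_min ltr01 divr_gt0.
have t1 : t <= 1 by rewrite ge_min lexx.
have tz : t * `|z| < d.
  apply: (@le_lt_trans _ _ (d / (2 * (`|z| + 1)) * `|z|)).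
    by rewrite ler_wpM2r// ge_min lexx orbT.
  by rewrite mulrAC ltr_pdivrMr//; have := normr_ge0 z; nra.
have wtE : t *: w + (1 - t) *: u = u + t *: z.
  by rewrite /z scalerBl scale1r scalerBr addrCA.
have Fwt := @F_convex t w u b lam ltac:(lra) Fw Fu; rewrite wtE in Fwt.
have distE : `|u - (u + t *: z)| = t * `|z|.
  by rewrite opprD addNKr normrN normrZ gtr0_norm.
have ball_wt : ball u d (u + t *: z) by rewrite -ball_normE /= distE.
have := ud _ ball_wt; rewrite /PhiL /Phi distE; case: asboolP; last first.
  case; split; last by apply: (le_trans Fwt); rewrite lee_fin; nra.
  rewrite -wtE; apply: (le_trans (ler_normD _ _)).
  rewrite !normrZ u1 gtr0_norm// ger0_norm; last by lra.
  by nra.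
move=> _; have := F_ge0 (u + t *: z); move: Fwt.
case: (F (u + t *: z)) => [c| |] // cb _; rewrite lee_fin in cb.
rewrite -!EFinB lee_fin ip_normD u1 expr1n ipZr normrZ exprMn real_normK ?num_real//.
have -> : ip u z = p by rewrite /z ipDr ipNr ipxx u1 expr1n.
set q := `|z| ^+ 2 => h.
have Lq : 0 <= L * (t ^+ 2 * q) by rewrite !mulr_ge0 ?sqr_ge0// ltW.
have ez : e / (`|z| + 1) * (t * `|z|) <= t * e.
  rewrite mulrCA ler_pM2l// mulrAC ler_pdivrMr//; nra.
by rewrite -(ler_pM2l t0); nra.
Qed.

(** To pass from [L] to [lam], [slope_segment] is used at the normalisation of [vt = u + t z]. There
    the term with [L] becomes [L * |vt - |vt| u|^2], of order [t^2], while homogeneity leaves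
    [lam * |vt|^2] as the first-order term. *)
Lemma slope_critical_point u : 0 <= lam -> lam + 1 < L -> `|u| = 1 -> Phi u = lam%:E ->
  descending_slope PhiL u = 0%E -> critical_point lam u.
Proof.
move=> lam0 lamL u1 Phiu slope0.
have seg := slope_segment lam0 lamL u1 Phiu slope0.
have Fu : (F u <= lam%:E)%E.
  by rewrite -Phiu /Phi; case: asboolP => // _; rewrite leey.
split=> // v b Fv; set p := ip u v - 1; set z := v - u; set q := `|z| ^+ 2.
have L0 : 0 < L by lra.
have q0 : 0 <= q by exact: sqr_ge0.
have Lq0 : 0 <= 4 * L * q by rewrite !mulr_ge0// ltW.
have uz : ip u z = p by rewrite /z ipDr ipNr ipxx u1 expr1n.
apply: (ler_small_perturbation Lq0) => t /andP[t0 t1].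
have vtE : t *: v + (1 - t) *: u = u + t *: z.
  by rewrite /z scalerBl scale1r scalerBr addrCA.
have := @F_convex t v u b lam ltac:(lra) Fv Fu; rewrite vtE.
set vt := u + t *: z; set c := t * b + (1 - t) * lam => Fvt.
have c0 := energy_bound_ge0 Fvt.
set N := `|vt|.
have N2 : N ^+ 2 = 1 + 2 * (t * p) + t ^+ 2 * q.
  by rewrite /N ip_normD u1 expr1n ipZr uz normrZ exprMn real_normK ?num_real.
have distE : `|vt - N *: u| ^+ 2 = 2 * N ^+ 2 - 2 * N * ip u vt.
  rewrite ip_normD normrN ipNr ipZr (ipC vt) normrZ u1 mulr1 normr_id -/N.
  by ring.
have dist_le : `|vt - N *: u| ^+ 2 <= 4 * (t ^+ 2 * q).
  have h : `|vt - N *: u| <= 2 * (t * `|z|).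
    have -> : vt - N *: u = t *: z + (1 - N) *: u.
      by rewrite scalerBl scale1r addrA; congr (_ - _); rewrite addrC.
    apply: (le_trans (ler_normD _ _)).
    rewrite !normrZ u1 mulr1 gtr0_norm// mulr2n mulrDl mul1r lerD2l.
    have := ler_dist_dist u vt; rewrite u1 -/N.
    by rewrite opprD addNKr normrN normrZ gtr0_norm.
  have -> : 4 * (t ^+ 2 * q) = (2 * (t * `|z|)) ^+ 2 by rewrite /q; ring.
  by rewrite ler_pXn2r ?nnegrE// !mulr_ge0// ltW.
suff claim : lam * N ^+ 2 - L * `|vt - N *: u| ^+ 2 <= c.
  have Ldist : L * `|vt - N *: u| ^+ 2 <= L * (4 * (t ^+ 2 * q)) by rewrite ler_pM2l.
  have lq : 0 <= lam * (t ^+ 2 * q).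
    by apply: mulr_ge0 => //; apply: mulr_ge0 => //; exact: sqr_ge0.
  by rewrite N2 /c in claim; rewrite -(ler_pM2l t0); nra.
have [N0|N0] := eqVneq N 0.
  rewrite N0 expr0n mulr0 sub0r; apply: le_trans c0.
  by rewrite oppr_le0 mulr_ge0 ?sqr_ge0// ltW.
have Ngt0 : 0 < N by rewrite lt_neqAle eq_sym N0 normr_ge0.
have N2gt0 : 0 < N ^+ 2 by rewrite exprn_gt0.
(* If the energy bound of the normalised vector exceeds [lam + 1], then [c > (lam + 1) * N^2] and
   the claim is immediate. *)
have [cle|clt] := leP (N^-1 ^+ 2 * c) (lam + 1).
  have w1 : `|N^-1 *: vt| <= 1.
    by rewrite normrZ gtr0_norm ?invr_gt0// mulVf.
  have := seg _ _ w1 (FZ N^-1 Fvt) cle.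
  rewrite ipZr distE -(ler_pM2l N2gt0) exprVn mulrA divff ?gt_eqF// mul1r.
  apply: le_trans; rewrite le_eqVlt; apply/orP; left; apply/eqP.
  by field.
rewrite exprVn ltr_pdivlMl// in clt.
have : 0 <= L * `|vt - N *: u| ^+ 2 by rewrite mulr_ge0 ?sqr_ge0// ltW.
nra.
Qed.

End truncation.
End inner_product.

(** * The inner product of L2 and the local slope *)


Section L2_inner_product.
Context d (T : measurableType d) (R : realType).
Variable mu : {measure set T -> \bar R}.
Local Notation L2 := (LspaceType2 mu).
Implicit Types u v w : L2.

Lemma L2inner_integrable u v :
  mu.-integrable setT (EFin \o (fun x => L2fun u x * L2fun v x)).
Proof. by apply/Lfun1_integrable/Lfun2_mul_Lfun1; exact: L2fun_Lfun. Qed.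

Lemma eq_ae_Rintegral (f g : T -> R) : measurable_fun setT f ->
  measurable_fun setT g -> f = g %[ae mu] ->
  \int[mu]_x f x = \int[mu]_x g x.
Proof.
move=> mf mg fg; congr fine; apply: ae_eq_integral => //.
- exact/measurable_EFinP.
- exact/measurable_EFinP.
- by apply: filterS fg => x /= /[apply] ->.
Qed.

Lemma L2innerC u v : L2inner u v = L2inner v u.
Proof. by apply: eq_Rintegral => x _; rewrite mulrC. Qed.

Lemma L2innerDl u v w : L2inner (u + v) w = L2inner u w + L2inner v w.
Proof.
rewrite -RintegralD//; [|exact: L2inner_integrable|exact: L2inner_integrable].
apply: eq_ae_Rintegral.
- by apply: measurable_funM; exact: measurable_L2fun.
- by apply: measurable_funD; apply: measurable_funM; exact: measurable_L2fun.
- by apply: filterS (L2funD u v) => x /= /[apply] ->; rewrite mulrDl.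
Qed.

Lemma L2innerZl a u v : L2inner (a *: u) v = a * L2inner u v.
Proof.
rewrite -RintegralZl//; last exact: L2inner_integrable.
apply: eq_ae_Rintegral.
- by apply: measurable_funM; exact: measurable_L2fun.
- by apply: measurable_funM => //; apply: measurable_funM; exact: measurable_L2fun.
- by apply: filterS (L2funZ a u) => x /= /[apply] ->; rewrite mulrA.
Qed.

(** Passes between functions, which enter the definition of [cheeger], and classes in [L2], where
    the norm inequalities are available. A finite distance to [u] puts [g] in [L2]. *)
Lemma Lnorm_lt_L2P (g : T -> R) u e : measurable_fun setT g ->
  ('N[mu]_2[EFin \o (g \- L2fun u)%R] < e%:E)%E <->
  exists w, L2fun w = g %[ae mu] /\ `|w - u| < e.
Proof.
move=> mg; have mgu : measurable_fun setT (g \- L2fun u).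
  by apply: measurable_funB => //; exact: measurable_L2fun.
have normE (z : L2) : 'N[mu]_2[EFin \o L2fun z]%E = `|z|%:E.
  by rewrite -(finite_norm_fine (L2Lfun z)).
split=> [ge|[w [wg wu]]].
  have guL : g \- L2fun u \in Lfun mu 2%:E.
    rewrite inE; apply/andP; split; rewrite inE//=.
    by rewrite /finite_norm (lt_trans ge)// ltry.
  exists (L2of guL + u); split.
    apply: filterS (filterI (L2funD (L2of guL) u) (L2ofE guL)) => x /= [e1 e2] _.
    by rewrite e1// e2//= subrK.
  by rewrite addrK -lte_fin -normE (Lnorm2_ae _ mgu (L2ofE guL))//; exact: measurable_L2fun.
rewrite (@Lnorm2_ae _ _ _ _ _ (L2fun (w - u)))//.
- by rewrite normE lte_fin.
- exact: measurable_L2fun.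
- apply: filterS (filterI (L2funD w (- u)) (filterI (L2funN u) wg)) => x /=.
  by move=> [e1 [e2 e3]] _; rewrite e1//= e2//= e3.
Qed.

End L2_inner_product.

(** * Local slopes of bounded Lipschitz functions *)

Section local_slope.
Context (R : realType) (X : completeMetricType R).
Implicit Types (g h : X -> R) (x y : X).

Lemma lipschitz_continuous g K : (forall x y, `|g x - g y| <= K * mdist x y) ->
  continuous g.
Proof.
move=> gK x; apply/cvgrPdist_le => e e0.
have K1 : 0 < `|K| + 1 by rewrite ltr_wpDl.
apply/nbhs_ballP; exists (e / (`|K| + 1)) => /=; first exact: divr_gt0.
move=> y; rewrite ballEmdist /= => /ltW xy; apply: (le_trans (gK x y)).
rewrite ler_pdivlMr// in xy; apply: le_trans xy; rewrite mulrC.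
by rewrite ler_wpM2l ?mdist_ge0// (le_trans (ler_norm K))// lerDl.
Qed.

Lemma mdist_continuous y : continuous (mdist y : X -> R).
Proof.
apply: (@lipschitz_continuous _ 1) => a b; rewrite mul1r ler_norml.
have h1 := metric_triangle y a b; have h2 := metric_triangle y b a.
by rewrite (metric_sym b a) in h2; lra.
Qed.

(** Without a quotient the bound also makes sense at [y = x], and isolated points need no separate
    treatment later. *)
Lemma local_slope_leP g x c : 0 <= c ->
  (local_slope g x <= c%:E)%E <->
  forall e, 0 < e -> \forall y \near x, `|g y - g x| <= (c + e) * mdist y x.
Proof.
move=> c0; rewrite /local_slope; case: asboolP => [[_ [U xU Ux]]|_].
  rewrite lee_fin; split=> // _ e e0; apply: filterS xU => y Uy.
  have -> : y = x by have : (U `&` setT) y by []; rewrite Ux.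
  by rewrite subrr normr0 mdistxx mulr0.
split=> [sle e e0|near_le].
  have : (limf_esup (fun y => (`|g y - g x| / mdist y x)%:E) x^' < (c + e)%:E)%E.
    by apply: (le_lt_trans sle); rewrite lte_fin ltrDl.
  move=> /ereal_inf_lt[_ [B xB <-] supB].
  have {}xB : \forall y \near x, y != x -> B y := xB.
  apply: filterS xB => y By; have [->|yx] := eqVneq y x.
    by rewrite subrr normr0 mdistxx mulr0.
  rewrite -ler_pdivrMr ?mdist_gt0// -lee_fin; apply: le_trans (ltW supB).
  by apply: ereal_sup_ubound; exists y => //; exact: By.
apply/lee_addgt0Pr => e e0; rewrite -EFinD.
pose B := [set y | y != x /\ `|g y - g x| <= (c + e) * mdist y x].
have xB : x^' B by rewrite /dnbhs; apply: filterS (near_le e e0).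
apply: (@le_trans _ _
    (ereal_sup ((fun y => (`|g y - g x| / mdist y x)%:E) @` B))).
  by apply: ereal_inf_lbound; exists B.
apply: ge_ereal_sup => _ [y [yx ye] <-].
by rewrite lee_fin ler_pdivrMr ?mdist_gt0.
Qed.

Lemma local_slope_ge0 g x : (0 <= local_slope g x)%E.
Proof.
(* At a non-isolated point no punctured neighbourhood is empty. *)
rewrite /local_slope; case: asboolP => // nx; apply: limf_esup_ge0 => [x0|y].
  apply: nx; split; first by rewrite inE.
  exists [set y | y = x]; last by rewrite setIT.
  have {}x0 : \forall y \near x, y != x -> False := x0.
  by apply: filterS x0 => y yx; apply: contrapT => /eqP.
by rewrite lee_fin divr_ge0// mdist_ge0.
Qed.

Lemma local_slope_fin g x : bounded_lipschitz g ->
  exists2 c, 0 <= c & local_slope g x = c%:E.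
Proof.
move=> [_ [K gK]].
have : (local_slope g x <= `|K|%:E)%E.
  apply/local_slope_leP => // e e0; apply: nearW => y.
  apply: (le_trans (gK y x)); rewrite ler_wpM2r ?mdist_ge0//.
  by rewrite (le_trans (ler_norm K))// lerDl ltW.
have := local_slope_ge0 g x; case: (local_slope g x) => [c| |] //.
by rewrite lee_fin; exists c.
Qed.

Lemma bounded_lipschitz_comb s t g h :
  bounded_lipschitz g -> bounded_lipschitz h ->
  bounded_lipschitz (fun x => s * g x + t * h x).
Proof.
move=> [[M gM] [K gK]] [[M' hM] [K' hK]]; split.
  exists (`|s| * M + `|t| * M') => x; rewrite (le_trans (ler_normD _ _))// !normrM.
  by rewrite lerD// ler_wpM2l.
exists (`|s| * K + `|t| * K') => x y.
have -> : s * g x + t * h x - (s * g y + t * h y) =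
    s * (g x - g y) + t * (h x - h y) by ring.
rewrite (le_trans (ler_normD _ _))// !normrM mulrDl -!mulrA.
by rewrite lerD// ler_wpM2l.
Qed.

Lemma local_slope_comb s t g h x a b : 0 <= a -> 0 <= b ->
  (local_slope g x <= a%:E)%E -> (local_slope h x <= b%:E)%E ->
  (local_slope (fun x => (s * g x + t * h x)%R) x <= (`|s| * a + `|t| * b)%:E)%E.
Proof.
move=> a0 b0 /(local_slope_leP _ _ a0) ga /(local_slope_leP _ _ b0) hb.
apply/local_slope_leP => [|e e0]; first by rewrite addr_ge0// mulr_ge0.
have st : 0 < `|s| + `|t| + 1 by rewrite ltr_wpDl// addr_ge0.
have e' : 0 < e / (`|s| + `|t| + 1) by exact: divr_gt0.
apply: filterS (filterI (ga _ e') (hb _ e')) => y [gy hy].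
have -> : s * g y + t * h y - (s * g x + t * h x) =
    s * (g y - g x) + t * (h y - h x) by ring.
rewrite (le_trans (ler_normD _ _))// !normrM.
apply: (@le_trans _ _ (`|s| * ((a + e / (`|s| + `|t| + 1)) * mdist y x) +
    `|t| * ((b + e / (`|s| + `|t| + 1)) * mdist y x))).
  by rewrite lerD// ler_wpM2l.
rewrite !mulrA -mulrDl ler_wpM2r ?mdist_ge0//.
have : (`|s| + `|t|) * (e / (`|s| + `|t| + 1)) <= e.
  by rewrite mulrA ler_pdivrMr// mulrC ler_wpM2l ?lerDl// ltW.
lra.
Qed.

Lemma open_borel (A : set X) : open A -> measurable (A : set (borel X)).
Proof. exact: sub_sigma_algebra. Qed.

Lemma bounded_lipschitz_measurable g : bounded_lipschitz g ->
  measurable_fun setT (g : borel X -> R).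
Proof.
move=> [_ [K /lipschitz_continuous cg]] mT.
apply: (measurability _ (RGenOpens.measurableE R)) => //.
move=> _ [_ [a [b ->]] <-]; rewrite setTI; apply: open_borel.
by apply: open_comp => [x _|]; [exact: cg|exact: interval_open].
Qed.

(** Writes the strict sublevel with countable quantifiers over the gap below [r] and the radius, as
    measurability requires. *)
Lemma local_slope_ltP g x r : bounded_lipschitz g -> 0 < r ->
  (local_slope g x < r%:E)%E <-> exists n k : nat,
    forall y, mdist y x < k.+1%:R^-1 ->
      `|g y - g x| <= (r - n.+1%:R^-1) * mdist y x.
Proof.
have small (e : R) : 0 < e -> exists n : nat, n.+1%:R^-1 <= e.
  by move=> /near_infty_invSn_le[N Ne]; exists N; exact: Ne.
move=> gL r0; split=> [|[n [k nk]]].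
  have [c c0 cE] := local_slope_fin x gL; rewrite cE lte_fin => cr.
  have [|n nr] := small ((r - c) / 2); first by rewrite divr_gt0// subr_gt0.
  have /(local_slope_leP _ _ c0) sle : (local_slope g x <= c%:E)%E by rewrite cE.
  have [|d /= d0 xd] := (nbhs_ballP _ _).1 (sle (r - n.+1%:R^-1 - c) _).
    by set z := n.+1%:R^-1 in nr *; lra.
  have [k kd] := small d d0; exists n, k => y yx.
  have : ball x d y by rewrite ballEmdist /= metric_sym (lt_le_trans yx).
  by move=> /xd /=; rewrite [c + _]addrC subrK.
have n0 : 0 < n.+1%:R^-1 :> R by rewrite invr_gt0.
(* The maximum with 0 is taken because [r - 1/(n+1)] may be negative. *)
apply: (@le_lt_trans _ _ (Num.max 0 (r - n.+1%:R^-1))%:E).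
  apply/local_slope_leP => [|e e0]; first by rewrite le_max lexx.
  apply/nbhs_ballP; exists k.+1%:R^-1 => /=; first by rewrite invr_gt0.
  move=> y; rewrite ballEmdist /= metric_sym => /nk/le_trans; apply.
  rewrite ler_wpM2r ?mdist_ge0//.
  by rewrite (@le_trans _ _ (Num.max 0 (r - n.+1%:R^-1)))// ?lerDl ?le_max ?lexx ?orbT// ltW.
by rewrite lte_fin gt_max r0 gtrBl.
Qed.

Lemma measurable_local_slope g : bounded_lipschitz g ->
  measurable_fun setT (local_slope g : borel X -> \bar R).
Proof.
move=> gL mT; apply: (measurability _ (ErealGenInftyO.measurableE R)) => //.
move=> _ [_ [r ->] <-]; rewrite setTI.
have [_ [K /lipschitz_continuous cg]] := gL.
have [r0|r0] := leP r 0.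
  rewrite (_ : _ @^-1` _ = set0) ?measurable0//.
  apply/seteqP; split=> x //=; rewrite in_itv /= ltNge => /negP; apply.
  by rewrite (le_trans _ (local_slope_ge0 g x))// lee_fin.
rewrite (_ : _ @^-1` _ = \bigcup_n \bigcup_k [set x | forall y, mdist y x < k.+1%:R^-1 ->
      `|g y - g x| <= (r - n.+1%:R^-1) * mdist y x]); last first.
  apply/seteqP; split=> x /=; rewrite in_itv /=.
    by move=> /(local_slope_ltP _ gL r0)[n [k nk]]; exists n => //; exists k.
  by move=> [n _ [k _ nk]]; apply/(local_slope_ltP _ gL r0); exists n, k.
apply: bigcup_measurable => n _; apply: bigcup_measurable => k _.
(* For fixed [n] and [k] the set is closed: its complement is a union over all [y] of sets that are
   open by continuity of [g] and of the distance. *)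
rewrite -[X in measurable X]setCK; apply: measurableC; apply: open_borel.
rewrite (_ : ~` _ = \bigcup_y ([set x | mdist y x < k.+1%:R^-1] `&`
    [set x | (r - n.+1%:R^-1) * mdist y x < `|g y - g x|])); last first.
  apply/seteqP; split=> x /=.
    move=> /existsNP[y /not_implyP[yx /negP]]; rewrite -ltNge => gy.
    by exists y.
  by move=> [y _ [yx gy]] /(_ y yx); rewrite leNgt gy.
apply: bigcup_open => y _; apply: openI.
  apply: (@open_comp _ _ (mdist y) [set z | z < k.+1%:R^-1]) => [x _|].
    exact: mdist_continuous.
  exact: open_lt.
have -> : [set x | (r - n.+1%:R^-1) * mdist y x < `|g y - g x|] =
    (fun x => `|g y - g x| - (r - n.+1%:R^-1) * mdist y x) @^-1` [set z | 0 < z].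
  by apply/seteqP; split=> x /=; rewrite subr_gt0.
apply: open_comp => [x _|]; last exact: open_gt.
apply: cvgB.
  by apply: cvg_norm; apply: cvgB; [exact: cvg_cst|exact: cg].
by apply: cvgM; [exact: cvg_cst|exact: mdist_continuous].
Qed.

End local_slope.

(** * The Cheeger energy *)

Section cheeger_energy.
Context (R : realType) (X : completeMetricType R).
Variable m : probability (borel X) R.
Local Notation L2 := (LspaceType2 m).
Implicit Types (u v w : L2) (g h : X -> R).

Definition dirichlet g : \bar R := (\int[m]_x (local_slope g x ^+ 2)%E)%E.

Let measurable_slope2 g : bounded_lipschitz g ->
  measurable_fun setT ((fun x => local_slope g x ^+ 2)%E : borel X -> \bar R).
Proof.
by move=> gL; apply: emeasurable_funM; exact: measurable_local_slope.
Qed.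

Let slope2_ge0 g x : (0 <= local_slope g x ^+ 2)%E.
Proof. by rewrite expe2 mule_ge0 ?local_slope_ge0. Qed.

(** Pointwise Cauchy-Schwarz: [(|s| a + |t| b)^2 <= (|s| + |t|) (|s| a^2 + |t| b^2)]. This form
    covers both convexity ([s + t = 1], nonnegative) and homogeneity ([t = 0]). *)
Lemma dirichlet_comb s t g h : bounded_lipschitz g -> bounded_lipschitz h ->
  (dirichlet (fun x => (s * g x + t * h x)%R) <= (`|s| + `|t|)%:E *
     (`|s|%:E * dirichlet g + `|t|%:E * dirichlet h))%E.
Proof.
move=> gL hL; have mg := measurable_slope2 gL; have mh := measurable_slope2 hL.
rewrite /dirichlet -!ge0_integralZl_EFin//.
rewrite -ge0_integralD//; last 4 first.
- by move=> x _; rewrite mule_ge0// lee_fin.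
- exact: measurable_funeM.
- by move=> x _; rewrite mule_ge0// lee_fin.
- exact: measurable_funeM.
rewrite -ge0_integralZl_EFin//; last 2 first.
- by move=> x _; rewrite adde_ge0// mule_ge0// lee_fin.
- by apply: emeasurable_funD; exact: measurable_funeM.
apply: ge0_le_integral => //.
- by apply: measurable_slope2; exact: bounded_lipschitz_comb.
- by apply: measurable_funeM; apply: emeasurable_funD; exact: measurable_funeM.
move=> x _.
have [a a0 aE] := local_slope_fin x gL; have [b b0 bE] := local_slope_fin x hL.
have [c c0 cE] := local_slope_fin x (bounded_lipschitz_comb s t gL hL).
have := @local_slope_comb _ _ s t g h x a b a0 b0.
rewrite aE bE cE !lee_fin => /(_ (lexx _) (lexx _)) cab.
have s0 := normr_ge0 s; have t0 := normr_ge0 t.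
have st0 : 0 <= `|s| * `|t| by exact: mulr_ge0.
have ab := sqr_ge0 (a - b).
apply: (@le_trans _ _ ((`|s| * a + `|t| * b) * (`|s| * a + `|t| * b))).
  by apply: ler_pM.
nra.
Qed.

(** The relaxation in [cheeger] without sequences: it follows from [Ch(u) < a] and implies
    [Ch(u) <= a]. *)
Definition lipschitz_approximable u (a : R) := forall e, 0 < e -> exists g w,
  [/\ bounded_lipschitz g, L2fun w = g %[ae m], `|w - u| < e &
      (dirichlet g <= a%:E)%E].

Lemma lipschitz_approximable_comb s t u v a b :
  lipschitz_approximable u a -> lipschitz_approximable v b ->
  lipschitz_approximable (s *: u + t *: v)
    ((`|s| + `|t|) * (`|s| * a + `|t| * b)).
Proof.
move=> ua vb e e0.
have st : 0 < `|s| + `|t| + 1 by rewrite ltr_wpDl// addr_ge0.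
have e' : 0 < e / (`|s| + `|t| + 1) by exact: divr_gt0.
have [g [w [gL wg wu ga]]] := ua _ e'; have [h [z [hL zh zv hb]]] := vb _ e'.
exists (fun x => s * g x + t * h x), (s *: w + t *: z); split.
- exact: bounded_lipschitz_comb.
- apply: filterS (filterI (L2funD (s *: w) (t *: z)) (filterI (L2funZ s w)
    (filterI (L2funZ t z) (filterI wg zh)))) => x /= [e1 [e2 [e3 [e4 e5]]]] _.
  by rewrite e1//= e2// e3//= e4// e5.
- have -> : s *: w + t *: z - (s *: u + t *: v) = s *: (w - u) + t *: (z - v).
    by rewrite !scalerBr opprD addrACA.
  apply: (le_lt_trans (ler_normD _ _)); rewrite !normrZ.
  apply: (@le_lt_trans _ _ ((`|s| + `|t|) * (e / (`|s| + `|t| + 1)))).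
    by rewrite mulrDl lerD// ler_wpM2l// ltW.
  rewrite mulrA ltr_pdivrMr// mulrC ltr_pM2l//; lra.
- apply: (le_trans (dirichlet_comb s t gL hL)).
  rewrite !EFinM EFinD lee_wpmul2l ?lee_fin ?addr_ge0//.
  by rewrite EFinD !EFinM leeD// lee_wpmul2l ?lee_fin.
Qed.

Lemma cheeger_ltP u a : (cheeger m u < a%:E)%E -> lipschitz_approximable u a.
Proof.
move=> /ereal_inf_lt[_ [g [gL gu] <-] gltE] e e0.
have [N _ Ne] : \forall n \near \oo, ('N[m]_2[EFin \o (g n \- L2fun u)%R] < e%:E)%E.
  have /fine_cvgP[fin /cvgrPdist_lt/(_ e e0)] := gu.
  move=> near_lt; apply: filterS (filterI fin near_lt) => n [/= fin_n].
  rewrite sub0r normrN ger0_norm ?fine_ge0 ?Lnorm_ge0// => lt_n.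
  by rewrite -(fineK fin_n) lte_fin.
(* If all energies from [N] on were at least [a], so would be the lower limit. *)
have [n Nn gna] : exists2 n, (N <= n)%N & (dirichlet (g n) < a%:E)%E.
  apply: contrapT => /forall2NP no; move: gltE; apply/negP; rewrite -leNgt.
  rewrite /limn_einf /limn_esup -/(limf_einf _ _) limf_einfE.
  apply: (@le_trans _ _ (ereal_inf ((fun n => dirichlet (g n)) @` [set n | (N <= n)%N]))).
    by apply: le_ereal_inf_tmp => _ [n /= Nn <-]; have [//|/negP] := no n; rewrite -leNgt.
  by apply: ereal_sup_ubound; exists [set n | (N <= n)%N] => //; exists N.
have mg := bounded_lipschitz_measurable (gL n).
have [w [wg wu]] := (Lnorm_lt_L2P _ _ mg).1 (Ne n Nn).
by exists (g n), w; split=> //; exact: ltW.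
Qed.

Lemma lipschitz_approximable_cheeger u a :
  lipschitz_approximable u a -> (cheeger m u <= a%:E)%E.
Proof.
move=> ua.
have /choice[g gP] (n : nat) : exists g, [/\ bounded_lipschitz g,
    ('N[m]_2[EFin \o (g \- L2fun u)%R] < (n.+1%:R^-1)%:E)%E &
    (dirichlet g <= a%:E)%E].
  have [|g [w [gL wg wu ga]]] := ua n.+1%:R^-1; first by rewrite invr_gt0.
  exists g; split=> //; apply/Lnorm_lt_L2P; first exact: bounded_lipschitz_measurable.
  by exists w.
apply: (@le_trans _ _ (limn_einf (fun n => dirichlet (g n)))).
  apply: ereal_inf_lbound; exists g => //; split=> [n|]; first by have [] := gP n.
  apply: (@squeeze_cvge _ _ _ _ (cst 0%E) _ (fun n => (n.+1%:R^-1)%:E)).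
  - by apply: nearW => n; rewrite Lnorm_ge0 ltW//; have [] := gP n.
  - exact: cvg_cst.
  - by apply: cvg_EFin; [exact: nearW|exact: cvg_harmonic].
rewrite /limn_einf /limn_esup -/(limf_einf _ _) limf_einfE.
apply: ge_ereal_sup => _ [V [N _ NV] <-].
apply: (@le_trans _ _ (dirichlet (g N))); last by have [] := gP N.
by apply: ereal_inf_lbound; exists N => //; apply: NV => /=.
Qed.

Lemma cheeger_ge0 u : (0 <= cheeger m u)%E.
Proof.
apply: le_ereal_inf_tmp => _ [g _ <-].
rewrite /limn_einf /limn_esup -/(limf_einf _ _) limf_einfE.
apply: le_ereal_sup_tmp; exists (ereal_inf ((fun n => dirichlet (g n)) @` setT)).
  by exists setT => //; exact: filterT.
by apply: le_ereal_inf_tmp => _ [n _ <-]; exact: integral_ge0.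
Qed.

Lemma cheeger_comb s t u v a b : (cheeger m u <= a%:E)%E ->
  (cheeger m v <= b%:E)%E -> (cheeger m (s *: u + t *: v)%R <=
    ((`|s| + `|t|) * (`|s| * a + `|t| * b))%:E)%E.
Proof.
move=> ua vb; apply/lee_addgt0Pr => e e0; rewrite -EFinD.
(* Raising [a] and [b] by [e / k] gives strict inequalities and raises the bound by
   [(|s| + |t|)^2 * e / k <= e]. *)
pose k := (`|s| + `|t|) ^+ 2 + 1.
have k0 : 0 < k by rewrite ltr_wpDl// sqr_ge0.
have ek : 0 < e / k by exact: divr_gt0.
have ua' : (cheeger m u < (a + e / k)%:E)%E.
  by apply: (le_lt_trans ua); rewrite lte_fin ltrDl.
have vb' : (cheeger m v < (b + e / k)%:E)%E.
  by apply: (le_lt_trans vb); rewrite lte_fin ltrDl.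
have h := lipschitz_approximable_cheeger
  (lipschitz_approximable_comb s t (cheeger_ltP ua') (cheeger_ltP vb')).
apply: (le_trans h); rewrite lee_fin.
have : (`|s| + `|t|) ^+ 2 * (e / k) <= e.
  by rewrite mulrA ler_pdivrMr// mulrC ler_wpM2l ?lerDl// ltW.
set d := e / k; lra.
Qed.

Lemma cheegerZ c u a : (cheeger m u <= a%:E)%E ->
  (cheeger m (c *: u)%R <= (c ^+ 2 * a)%:E)%E.
Proof.
move=> ua; have := cheeger_comb c 0 ua ua.
rewrite scale0r addr0 normr0 mul0r !addr0 mulrA -expr2.
by rewrite real_normK ?num_real.
Qed.

Lemma cheeger_convex t u v a b : 0 <= t <= 1 -> (cheeger m u <= a%:E)%E ->
  (cheeger m v <= b%:E)%E ->
  (cheeger m (t *: u + (1 - t) *: v)%R <= (t * a + (1 - t) * b)%:E)%E.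
Proof.
move=> /andP[t0 t1] ua vb; have := cheeger_comb t (1 - t) ua vb.
by rewrite !ger0_norm ?subr_ge0// addrCA subrr addr0 mul1r.
Qed.

(** For minimality, any subgradient [w] is tested at [(1 - t) u]: homogeneity gives [<w, u> >= lam]
    as [t] tends to 0, and Cauchy-Schwarz turns this into [|w| >= lam = |lam u|]. *)
Lemma critical_point_laplacian lam u : 0 <= lam ->
  critical_point (@L2inner _ _ _ m) (cheeger m) lam u ->
  is_minus_laplacian m u (lam *: u).
Proof.
move=> lam0 critu; have [u1 Fu crit] := critu.
have chu := critical_point_energy (@L2innerxx _ _ _ m) cheeger_ge0 critu.
split=> [|w [_ sub]].
  split=> [|v]; rewrite chu -EFinM ?ltry//.
  have := cheeger_ge0 v; case chv : (cheeger m v) => [b| |] // _; last first.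
    by rewrite gt0_muley ?leey// lte_fin invr_gt0.
  have := crit v b; rewrite chv => /(_ (lexx _)) h.
  rewrite -EFinM -EFinD lee_fin L2innerZl (ipDr (@L2innerC _ _ _ m) (@L2innerDl _ _ _ m)).
  rewrite (ipNr (@L2innerC _ _ _ m) (@L2innerZl _ _ _ m)) L2innerxx u1 expr1n; lra.
rewrite normrZ u1 mulr1 ger0_norm//.
have wu := ip_le_norm (@L2innerC _ _ _ m) (@L2innerDl _ _ _ m) (@L2innerZl _ _ _ m)
  (@L2innerxx _ _ _ m) w u.
rewrite u1 mulr1 in wu; apply: le_trans wu.
apply: (ler_small_perturbation lam0) => t /andP[t0 t1].
have := sub ((1 - t) *: u); rewrite chu.
have -> : (1 - t) *: u - u = - (t *: u).
  by rewrite scalerBl scale1r addrAC subrr add0r.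
rewrite (ipNr (@L2innerC _ _ _ m) (@L2innerZl _ _ _ m))
  (ipZr (@L2innerC _ _ _ m) (@L2innerZl _ _ _ m)).
have Ft : (cheeger m u <= lam%:E)%E by rewrite chu.
have := cheegerZ (1 - t) Ft.
have := cheeger_ge0 ((1 - t) *: u); case: (cheeger m _) => [b| |] // _.
rewrite !lee_fin => b1 b2.
rewrite -(ler_pM2l t0); nra.
Qed.

End cheeger_energy.

(** * Min-max levels of the Cheeger energy and eigenfunctions *)

Theorem theorem7p4 (R : realType) (X : completeMetricType R)
    (m : probability (borel X) R) (k l : nat) (lam L : R) :
  metric_measure_space m ->
  (forall M : R, 0 < M -> compact (energy_sublevel m M)) ->
  (1 <= k)%N -> (1 <= l)%N -> 0 <= lam -> lam + 1 < L ->
  (forall j : nat, (k <= j <= k + l - 1)%N -> minmax (cheeger m) j = lam%:E) ->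
  [/\ ((l%:R)%:E <= genus (critical_set m lam L))%E,
      critical_set m lam L !=set0,
      exists u : LspaceType2 m, unit_sphere u /\
        is_minus_laplacian m u (fine (minmax (cheeger m) k) *: u) &
      (1 < l)%N ->
        infinite_set [set u : LspaceType2 m | unit_sphere u /\
          is_minus_laplacian m u (fine (minmax (cheeger m) k) *: u)]].
Proof.
move=> _ cpt k1 l1 lam0 lamL minmaxE.
have ipC := @L2innerC _ _ _ m; have ipD := @L2innerDl _ _ _ m.
have ipZ := @L2innerZl _ _ _ m; have ipxx := @L2innerxx _ _ _ m.
have ch0 := @cheeger_ge0 _ _ m; have chZ := @cheegerZ _ _ m.
have chconv := @cheeger_convex _ _ m.
have mk : minmax (cheeger m) k = lam%:E by apply: minmaxE; lia.
have mkl : minmax (cheeger m) (k + l - 1) = lam%:E by apply: minmaxE; lia.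
have KE : critical_set m lam L = critical_point (@L2inner _ _ _ m) (cheeger m) lam.
  apply/seteqP; split=> [u [u1 Phiu slope0]|u critu].
    exact: (slope_critical_point ipC ipD ipZ ipxx ch0 chZ chconv lam0 lamL u1 Phiu slope0).
  have [Phiu slope0] :=
    critical_point_slope ipC ipD ipZ ipxx ch0 lam0 lamL critu.
  by split=> //; have [] := critu.
have gK := genus_critical_point ipC ipD ipZ ipxx ch0 chZ chconv cpt lam0 k1 l1 mk mkl.
have Ksol u : critical_set m lam L u -> unit_sphere u /\
    is_minus_laplacian m u (fine (minmax (cheeger m) k) *: u).
  rewrite KE mk /= => critu; split; first by have [] := critu.
  exact: critical_point_laplacian.
rewrite -KE in gK.
(* The empty set has genus 0, which is less than [l]. *)
have [u Ku] : critical_set m lam L !=set0.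
  apply/set0P; apply/eqP => K0; move: gK; rewrite /genus.
  by case: asboolP => // _; rewrite lee_fin lern0; lia.
split=> //; [by exists u|by exists u; exact: Ksol|].
move=> l2; apply: (sub_infinite_set (A := critical_set m lam L)) => //.
(* A finite critical set, being symmetric and without 0, would have genus at most 1. *)
move=> finK; move: gK; apply/negP; rewrite -ltNge.
apply: (@le_lt_trans _ _ 1%:E); last by rewrite lte_fin ltr1n.
apply: finite_genus_le1 => //.
  by rewrite KE; apply/symmetric_setP => v; apply: critical_pointN.
by move=> v [v1 _ _]; rewrite /= -normr_gt0 v1.
Qed.
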